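(* For every integer $n\ge 2$, $$c(SL_n)\le \left(\frac{4}{\pi^2}\right)^{n-2},$$ where $c(SL_n)$ is the quantity $c(G)$ for $G=SL_n(\mathbb C)$.
   Context: For a simply connected simple complex Lie group $G$, let $G_c\subset G$ be a maximal compact subgroup with Lie algebra $\mathfrak g_c$, $\mathfrak h_c\subset\mathfrak g_c$ a Cartan subalgebra, $\mathfrak g,\mathfrak h$ the complexifications of $\mathfrak g_c,\mathfrak h_c$, and $\mathfrak h_{\mathbb R}$ the real part of $\mathfrak h$, i.e. $\mathfrak h_c=i\mathfrak h_{\mathbb R}$. The pairing between $\mathfrak g^*$ and $\mathfrak g$ is $(\cdot,\cdot)$; an element $\lambda\in\mathfrak h_{\mathbb R}^*$ is regarded as an element of $\mathfrak g^*$ vanishing on all root spaces. Asymptotic character: for $\lambda\in\mathfrak h_{\mathbb R}^*$ and $x\in\mathfrak h_{\mathbb R}$, $$X(\lambda,x):=\int_{O_\lambda}e^{i(b,x)}\,db,$$ where $O_\lambda\subset\mathfrak g^*$ is the $G_c$-orbit of $\lambda$ and $db$ is the $G_c$-invariant probability measure on $O_\lambda$. For $\lambda\in\mathfrak h_{\mathbb R}^*\setminus 0$ put $c(G,\lambda):=-\inf_{x\in\mathfrak h_{\mathbb R}}\mathrm{Re}\,X(\lambda,x)$, and $c(G):=\inf_{\lambda\in\mathfrak h_{\mathbb R}^*\setminus 0}c(G,\lambda)$. *)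

(* Defs.v *)
From mathcomp Require Import all_boot all_order all_algebra.
From mathcomp Require Import spectral complex.
From mathcomp Require Import all_classical all_reals all_analysis.

Set Implicit Arguments.
Unset Strict Implicit.
Unset Printing Implicit Defensive.

Import Order.TTheory GRing.Theory Num.Theory.
Import numFieldNormedType.Exports.

Local Open Scope classical_set_scope.
Local Open Scope complex_scope.
Local Open Scope ring_scope.

(* The cast to [numFieldType] is what gives [R[i]], hence the matrices over it,
   their usual topology. *)
Definition mxC (R : realType) (n : nat) := 'M[(R[i] : numFieldType)]_n.

Definition borelMxC (R : realType) (n : nat) :=
  g_sigma_algebraType (@open (mxC R n)).

Definition SU (R : realType) (n : nat) : set 'M[R[i]]_n :=
  [set U | U \is unitarymx /\ \det U = 1].
Arguments SU : clear implicits.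

(* [sl_n^*] is identified with [sl_n] through the invariant nondegenerate form
   [tr (b x)].  Under this identification the coadjoint action of [U] in [SU_n]
   is the conjugation [b |-> U b U^*], and the functionals vanishing on all root
   spaces are the diagonal matrices. *)
Definition pairing (R : realType) (n : nat) (b x : 'M[R[i]]_n) : R[i] :=
  \tr (b *m x).

Definition coadjoint (R : realType) (n : nat) (U b : 'M[R[i]]_n) : 'M[R[i]]_n :=
  U *m b *m invmx U.

(* [h_R] consists of the real traceless diagonal matrices, given by the row of
   their diagonal entries; by the identification above, so does [h_R^*]. *)
Definition cartanR (R : realType) (n : nat) : set 'rV[R]_n :=
  [set x | \sum_(i < n) x 0 i = 0].
Arguments cartanR : clear implicits.

Definition cartan_mx (R : realType) (n : nat) (x : 'rV[R]_n) : 'M[R[i]]_n :=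
  diag_mx (map_mx (real_complex R) x).

Definition orbit_SU (R : realType) (n : nat) (l : 'rV[R]_n) : set 'M[R[i]]_n :=
  [set coadjoint U (cartan_mx l) | U in SU R n].

Definition is_orbit_measure (R : realType) (n : nat) (l : 'rV[R]_n)
    (mu : probability (borelMxC R n) R) : Prop :=
  mu (orbit_SU l) = 1%E /\
  forall U, SU R n U -> forall A : set (borelMxC R n), measurable A ->
    mu (coadjoint U @^-1` A) = mu A.

(* "The" invariant probability measure on the orbit: it exists and is unique,
   so the Dirac mass that [xget] requires as a default value is never used. *)
Definition orbit_measure (R : realType) (n : nat) (l : 'rV[R]_n) :
    probability (borelMxC R n) R :=
  xget (\d_(0 : borelMxC R n) : {classic probability (borelMxC R n) R})
    [set mu | is_orbit_measure l mu].

Definition cexp (R : realType) (z : R[i]) : R[i] :=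
  (expR (complex.Re z) * cos (complex.Im z)) +i*
  (expR (complex.Re z) * sin (complex.Im z)).

Definition Cintegral (d : measure_display) (T : measurableType d) (R : realType)
    (mu : {measure set T -> \bar R}) (D : set T) (f : T -> R[i]) : R[i] :=
  (\int[mu]_(t in D) complex.Re (f t)) +i* (\int[mu]_(t in D) complex.Im (f t)).

Definition asymp_char (R : realType) (n : nat) (l x : 'rV[R]_n) : R[i] :=
  Cintegral (orbit_measure l) (orbit_SU l)
    (fun b => cexp ('i * pairing b (cartan_mx x))).

Definition c_SL_at (R : realType) (n : nat) (l : 'rV[R]_n) : \bar R :=
  (- ereal_inf [set (complex.Re (asymp_char l x))%:E | x in cartanR R n])%E.

Definition c_SL (R : realType) (n : nat) : \bar R :=
  ereal_inf [set c_SL_at l | l in [set l | cartanR R n l /\ l != 0]].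

(* Main.v *)
(* Take [lambda = rho], with [rho_j = (n-1)/2 - j].  Then [X (rho, x)] is the product
   over [j < k] of [sinc ((x_j - x_k)/2)].  If it is negative, some [|x_i - x_j|]
   exceeds [2 pi]; for each of the [n-2] other indices [k], the arguments of
   [sinc ((x_i - x_k)/2)] and [sinc ((x_j - x_k)/2)] then have absolute values adding up
   to at least [pi], so that their product is at most [4/pi^2] in absolute value, and
   all other factors are at most [1].

   The product formula follows from the invariance of the measure alone.  Write [E] for
   the mean over the orbit and [W b = e^{i (b, x)}].  Invariance says that the
   derivative of any function along [[E_{k,i}, b]] has mean zero.  Applied to [W] times
   the adjugate entry [(k, i)] of a principal submatrix of ['X - b], it gives, by
   induction on the submatrix, that the mean of [W] times
   [prod_(k != i) ((x_i - x_k) - 'i d/dX)] applied to the characteristic polynomial of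
   [b] and evaluated at [b i i] vanishes.  On the orbit this polynomial is
   [prod_j ('X - lambda_j)].  If [U_p (t)] denotes the same mean for an arbitrary
   polynomial [p] and [x_i = t], then [U_p' = 'i U_{'X p}]; hence
   [p = prod_(k != j) ('X - lambda_k)] gives a multiple of [e^{i lambda_j t}], and
   [prod_(k != i) (t - x_k) X (lambda, x) = U_1 (t)] is a combination of these
   exponentials.  For [lambda = rho], its zeros [t = x_k] determine it up to a constant
   factor. *)

Require Import Defs.
From mathcomp Require Import all_boot all_order all_algebra all_fingroup.
From mathcomp Require Import spectral complex.
From mathcomp Require Import all_classical all_reals all_analysis.
From mathcomp Require Import measurable_realfun ring lra.

Set Implicit Arguments.
Unset Strict Implicit.
Unset Printing Implicit Defensive.

Import Order.TTheory GRing.Theory Num.Theory.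
Import numFieldNormedType.Exports.
Import ComplexField.Normc.

Local Open Scope classical_set_scope.
Local Open Scope complex_scope.
Local Open Scope ring_scope.
Local Open Scope sesquilinear_scope.

(** * Products of sincs *)

(** The operators [(x_i - x_k) - 'i d/dX] are forced by invariance. Along [[E_{k,i}, b]] the entry
    [b i i] varies by [- b i k], and [W b] by [- 'i (x_i - x_k) b i k W b]. Both variations carry
    the factor [b i k], so on [W b] times a polynomial [p] evaluated at [b i i] they add up to
    [- 'i b i k W b] times one such operator applied to [p]. In turn, [b i k] times the adjugate
    entry [(k, i)] is a term of the Laplace expansion of the characteristic determinant along row
    [i]. Two obstacles shape the rest. Differentiation under the mean is done through first order
    expansions whose remainder is a constant times [h^2], uniformly on the orbit; a mean derivative
    [e] then satisfies [t e = O(t^2)] and vanishes. Hence two generic points are compared by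
    changing one coordinate at a time, and limits along lines reach every point, including the
    origin, which fixes the normalization. *)

Lemma prod_pairs_split (R : comRingType) n (f : 'I_n -> 'I_n -> R)
    (P : pred 'I_n) i : (forall j k, f j k = f k j) -> P i ->
  \prod_(j | P j) \prod_(k | P k && (j < k)%N) f j k =
  \prod_(k | P k && (k != i)) f i k *
  \prod_(j | P j && (j != i)) \prod_(k | (P k && (k != i)) && (j < k)%N) f j k.
Proof.
move=> fC Pi; rewrite (bigD1 i) //=.
under [X in _ * X]eq_bigr => j Pj.
  rewrite (_ : \prod_(k | _) _ = (if (j < i)%N then f i j else 1) *
    \prod_(k | (P k && (k != i)) && (j < k)%N) f j k); last first.
    case: ifPn => ji.
      rewrite (bigD1 i) ?Pi //= fC; congr (_ * _).
      by apply: eq_bigl => k; rewrite andbAC.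
    rewrite mul1r; apply: eq_bigl => k; case: eqVneq => [->|_]; last by rewrite andbT.
    by rewrite (negbTE ji) !andbF.
  over.
rewrite big_split /= mulrA; congr (_ * _).
rewrite [RHS](bigID (fun k : 'I_n => (i < k)%N)) /=; congr (_ * _).
  by apply: eq_bigl => k; case: (ltnP i k) => ik; rewrite ?andbF ?andbT // -val_eqE /= gtn_eqF // andbT.
rewrite -big_mkcondr; apply: eq_bigl => k.
by rewrite -val_eqE /=; case: ltngtP; rewrite ?andbF ?andbT.
Qed.

Section Sinc.
Variable R : realType.
Implicit Types x t a b : R.

Definition sinc t : R := if t == 0 then 1 else sin t / t.

Lemma sincN t : sinc (- t) = sinc t.
Proof. by rewrite /sinc oppr_eq0 sinN mulNr invrN mulrN opprK. Qed.

Lemma sinc_norm t : sinc `|t| = sinc t.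
Proof. by case: (ger0P t) => // _; rewrite sincN. Qed.

Lemma sin_eq0_sinc t : sin t != 0 -> sinc t != 0.
Proof.
move=> st; rewrite /sinc; case: (eqVneq t 0) => [_|t0]; first exact: oner_neq0.
by rewrite mulf_neq0 // invr_eq0.
Qed.

Lemma norm_sin_le t : `|sin t| <= `|t|.
Proof.
wlog t0 : t / 0 <= t.
  move=> H; case: (ger0P t) => [t0|/ltW t0]; first by rewrite -{2}(ger0_norm t0) H.
  by rewrite -(normrN (sin t)) -sinN -{2}(ger0_norm (_ : 0 <= - t)) ?H ?oppr_ge0.
have [->|tn0] := eqVneq t 0; first by rewrite sin0.
have {tn0} tgt : 0 < t by rewrite lt_def tn0.
have [c _] := @MVT R sin cos 0 t tgt (fun z _ => is_derive_sin z) (continuous_subspaceT (@continuous_sin R)).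
rewrite sin0 !subr0 => ->; rewrite normrM (ger0_norm t0) ler_piMl //.
by rewrite ler_norml cos_geN1 cos_le1.
Qed.

Lemma norm_sinc_le1 t : `|sinc t| <= 1.
Proof.
rewrite /sinc; case: eqP => [_|/eqP t0]; first by rewrite normr1.
by rewrite normrM normfV ler_pdivrMr ?normr_gt0 // mul1r norm_sin_le.
Qed.

Lemma norm_sinc_le t : t != 0 -> `|sinc t| <= `|t|^-1.
Proof.
move=> t0; rewrite /sinc (negbTE t0) normrM normfV ler_piMl //.
by rewrite ler_norml sin_geN1 sin_le1.
Qed.

Lemma norm_cosB1_le t : `|cos t - 1| <= t ^+ 2 / 2.
Proof.
have -> : cos t - 1 = - 2 * sin (t / 2) ^+ 2.
  rewrite {1}(_ : t = t / 2 + t / 2); last by field.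
  rewrite cosD -!expr2; have := cos2Dsin2 (t / 2); set c := cos _; set s := sin _.
  by move=> ?; lra.
rewrite normrM normrX normrN [`|2|]ger0_norm //.
rewrite (_ : t ^+ 2 / 2 = 2 * `|t / 2| ^+ 2); last first.
  by rewrite real_normK ?num_real //; field.
by rewrite ler_pM2l // lerXn2r ?nnegrE // norm_sin_le.
Qed.

Lemma norm_cosB1_le1 t : `|cos t - 1| <= `|t|.
Proof.
have [t2|t2] := leP `|t| 2.
  rewrite (le_trans (norm_cosB1_le t)) // -(real_normK (num_real t)).
  have := normr_ge0 t; nra.
have : `|cos t - 1| <= 2 by rewrite ler_norml; have := cos_geN1 t; have := cos_le1 t; lra.
lra.
Qed.

Lemma norm_sinB_le t : `|sin t - t| <= t ^+ 2.
Proof.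
wlog t0 : t / 0 < t.
  move=> H; case: (ltgtP 0 t) => [/H//|t0|<-]; last by rewrite sin0 subrr normr0 expr2 mulr0.
  have := H (- t); rewrite oppr_gt0 sinN -opprB opprK addrC normrN sqrrN.
  rewrite -opprB addrC normrN; apply; exact: t0.
have [c] := @MVT R (fun z => sin z - z) (fun z => cos z - 1) 0 t t0
  (fun z _ => @is_deriveB _ _ _ _ _ _ _ _ _ (is_derive_sin z) (is_derive_id z 1))
  (continuous_subspaceT (fun z => cvgB (@continuous_sin R z) cvg_id)).
rewrite in_itv /= sin0 !subr0 => /andP[c0 ct] ->.
rewrite normrM (gtr0_norm t0) expr2 ler_pM2r //.
by rewrite (le_trans (norm_cosB1_le1 c)) // gtr0_norm // ltW.
Qed.

Lemma cvg_sinc0 c : (fun e => sinc (c * e)) @ 0^'+ --> (1 : R).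
Proof.
have [->|c0] := eqVneq c 0.
  rewrite (_ : (fun _ => _) = cst 1); first exact: cvg_cst.
  by apply/funext => e; rewrite mul0r /sinc eqxx.
apply/cvgrPdist_le => e e0; near=> x.
have x0 : 0 < x by near: x; exact: nbhs_right_gt.
have cx0 : c * x != 0 by rewrite mulf_neq0 // gt_eqF.
rewrite /sinc (negbTE cx0).
have -> : 1 - sin (c * x) / (c * x) = - ((sin (c * x) - c * x) / (c * x)) by field; rewrite c0 gt_eqF.
rewrite normrN normrM normfV ler_pdivrMr ?normr_gt0 //.
rewrite (le_trans (norm_sinB_le _)) // -(real_normK (num_real _)) expr2 ler_pM2r ?normr_gt0 //.
rewrite normrM (gtr0_norm x0) -ler_pdivlMl ?normr_gt0 //.
near: x; apply: nbhs_right_le; by rewrite mulr_gt0 // invr_gt0 normr_gt0.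
Unshelve. all: by end_near. Qed.

Lemma cvg_sinc a c : (fun e => sinc (a + c * e)) @ 0^'+ --> sinc a.
Proof.
have [->|a0] := eqVneq a 0.
  rewrite {2}/sinc eqxx; under eq_fun do rewrite add0r; exact: cvg_sinc0.
have H : (fun e : R => a + c * e) @ 0^'+ --> a.
  rewrite -[X in _ --> X](_ : a + c * 0 = a); last by rewrite mulr0 addr0.
  apply: cvg_at_right_filter; apply: cvgD; first exact: cvg_cst.
  by apply: cvgM; [exact: cvg_cst|exact: cvg_id].
rewrite {2}/sinc (negbTE a0).
apply: (@cvg_trans _ ((fun e => sin (a + c * e) / (a + c * e)) @ 0^'+)).
  apply: near_eq_cvg; near=> e.
  rewrite /sinc ifF //; apply/negbTE; near: e.
  apply: (@cvgr_neq0 _ _ _ _ _ _ _ H a0).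
apply: cvgM; first exact: (continuous_cvg _ (@continuous_sin R a) H).
exact: cvgV.
Unshelve. all: by end_near. Qed.

(** Zeros of the sine are simple: where [sin a = 0], the addition formula leaves
    [cos a * sin (c * e)]. This provides generic points close to any given one. *)
Lemma near_sin_neq0 a c : c != 0 -> \forall e \near 0^'+, sin (a + c * e) != 0.
Proof.
move=> c0; have [sa|sa] := eqVneq (sin a) 0; last first.
  have H : (fun e : R => sin (a + c * e)) @ 0^'+ --> sin a.
    apply: (continuous_cvg _ (@continuous_sin R a)).
    rewrite -[X in _ --> X](_ : a + c * 0 = a); last by rewrite mulr0 addr0.
    apply: cvg_at_right_filter; apply: cvgD; first exact: cvg_cst.
    by apply: cvgM; [exact: cvg_cst|exact: cvg_id].
  exact: (@cvgr_neq0 _ _ _ _ _ _ _ H sa).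
have ca : cos a != 0.
  by apply/eqP => ca; have /eqP := cos2Dsin2 a; rewrite ca sa expr0n addr0 eq_sym oner_eq0.
near=> e.
have e0 : 0 < e by near: e; exact: nbhs_right_gt.
rewrite sinD sa mul0r add0r mulf_neq0 //.
have : 0 < sin (`|c| * e).
  apply: sin_gt0_pi; rewrite mulr_gt0 ?normr_gt0 //=.
  rewrite -ltr_pdivlMl ?normr_gt0 //; near: e; apply: nbhs_right_lt.
  by rewrite mulr_gt0 ?pi_gt0 // invr_gt0 normr_gt0.
by case: (ger0P c) => _ /lt0r_neq0 //; rewrite mulNr sinN oppr_eq0.
Unshelve. all: by end_near. Qed.

(** Concavity of the sine: the chord slopes on [[0, t]] and [[t, pi / 2]] are cosines at an earlier
    and at a later point. *)
Lemma jordan_sin t : 0 <= t <= pi / 2 -> 2 * t <= pi * sin t.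
Proof.
have pi0 := @pi_gt0 R; move=> /andP[t0 tp].
have [->|/eqP/eqP tn0] := eqVneq t 0; first by rewrite sin0 !mulr0.
have [->|tnp] := eqVneq t (pi / 2); first by rewrite sin_pihalf mulr1 mulrC divfK.
have {}t0 : 0 < t by rewrite lt_def tn0.
have {}tp : t < pi / 2 by rewrite lt_def eq_sym tnp.
have [c] := @MVT R sin cos _ _ t0 (fun z _ => is_derive_sin z) (continuous_subspaceT (@continuous_sin R)).
have [d] := @MVT R sin cos _ _ tp (fun z _ => is_derive_sin z) (continuous_subspaceT (@continuous_sin R)).
rewrite !in_itv /= sin0 sin_pihalf !subr0 => /andP[td dp] Ed /andP[c0 ct] Ec.
have H : cos d <= cos c.
  by rewrite ltW // ltr_cos ?in_itv /= ?(lt_trans ct td); lra.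
have : t * (1 - sin t) <= sin t * (pi / 2 - t).
  rewrite Ed Ec (mulrC t) -mulrA [_ * t]mulrC mulrA -(mulrA (cos c)) (mulrC t) mulrA.
  by rewrite mulrAC ler_pM2r ?subr_gt0 // ler_pM2r.
lra.
Qed.

Lemma pi_le4 : (pi : R) <= 4.
Proof. by have := @pihalf_lt2 R; lra. Qed.

(* [sin a sin b = sin^2 s - sin^2 d] with [s = (a+b)/2 >= pi/2] and [d = |a-b|/2], where
   [pi sin d >= 2 d]; hence [pi^2 sin a sin b <= pi^2 - (a-b)^2 <= 4 a b]. *)
Lemma sinc_pair_le a b : pi <= `|a| + `|b| -> `|sinc a| * `|sinc b| <= 4 / pi ^+ 2.
Proof.
rewrite -(sinc_norm a) -(sinc_norm b); move: (normr_ge0 a) (normr_ge0 b).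
move: `|a| `|b| => {}a {}b a0 b0 ab.
have pi0 := @pi_gt0 R; have pi4 := pi_le4.
(* An argument beyond [pi] gives the bound alone, as [1 / pi <= 4 / pi ^+ 2] by [pi <= 4]. Otherwise
   both arguments lie strictly between [0] and [pi], where the sines are positive. *)
have large t : pi <= t -> `|sinc t| <= 4 / pi ^+ 2.
  move=> tp; have tgt : 0 < t by exact: lt_le_trans tp.
  rewrite (le_trans (norm_sinc_le _)) ?gt_eqF // gtr0_norm //.
  rewrite ler_pdivlMr ?exprn_gt0 // ler_pdivrMl //; nra.
have [/large ap|ap] := leP pi a.
  by rewrite (le_trans _ ap) // ler_piMr // norm_sinc_le1.
have [/large bp|bp] := leP pi b.
  by rewrite (le_trans _ bp) // ler_piMl // norm_sinc_le1.
have {}a0 : 0 < a by lra.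
have {}b0 : 0 < b by lra.
rewrite /sinc !gt_eqF // !ger0_norm; try by rewrite divr_ge0 // ?ltW // sin_gt0_pi // ?a0 ?b0.
rewrite mulf_div ler_pdivrMr ?mulr_gt0 // mulrAC ler_pdivlMr ?exprn_gt0 //.
pose d := `|a - b| / 2; pose s := (a + b) / 2.
have d0 : 0 <= d by rewrite /d divr_ge0.
have dp : d <= pi / 2 by rewrite /d ler_pM2r ?invr_gt0 // ler_norml; lra.
have E : sin a * sin b = sin s ^+ 2 - sin d ^+ 2.
  have -> : sin d ^+ 2 = sin ((a - b) / 2) ^+ 2.
    by rewrite /d; case: (ger0P (a - b)) => // _; rewrite mulNr sinN sqrrN.
  have -> : sin a = sin (s + (a - b) / 2) by congr sin; rewrite /s; field.
  have -> : sin b = sin (s - (a - b) / 2) by congr sin; rewrite /s; field.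
  rewrite sinB sinD; have := cos2Dsin2 s; have := cos2Dsin2 ((a - b) / 2).
  set S := sin s; set C := cos s; set S' := sin _; set C' := cos _ => H1 H2.
  have -> : (S * C' + C * S') * (S * C' - C * S') = S ^+ 2 * C' ^+ 2 - C ^+ 2 * S' ^+ 2 by ring.
  by rewrite -[C' ^+ 2](addrK (S' ^+ 2)) -[C ^+ 2](addrK (S ^+ 2)) H1 H2; ring.
have J : 2 * d <= pi * sin d by apply: jordan_sin; rewrite d0.
have sd1 := sin_le1 d; have sd0 : 0 <= pi * sin d by lra.
have S1 : sin s ^+ 2 <= 1 by have := cos2Dsin2 s; have := sqr_ge0 (cos s); lra.
have J2 : (2 * d) ^+ 2 <= (pi * sin d) ^+ 2 by rewrite lerXn2r ?nnegrE //; lra.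
have dE : (2 * d) ^+ 2 = (a - b) ^+ 2.
  by rewrite /d mulrC divfK // real_normK ?num_real.
rewrite dE exprMn in J2; rewrite E.
have pp : 0 < pi ^+ 2 :> R by rewrite exprn_gt0.
have Q : pi ^+ 2 <= (a + b) ^+ 2 by rewrite lerXn2r ?nnegrE //; lra.
have : sin s ^+ 2 * pi ^+ 2 <= 1 * pi ^+ 2 by rewrite ler_pM2r.
move: J2 Q; rewrite !expr2; lra.
Qed.

Variable n : nat.
Implicit Types u : 'I_n -> R.

Definition sinc_prod u : R :=
  \prod_(j < n) \prod_(k < n | (j < k)%N) sinc ((u j - u k) / 2).

Lemma sinc_subC u j k : sinc ((u j - u k) / 2) = sinc ((u k - u j) / 2).
Proof. by rewrite -sincN -mulNr opprB. Qed.

Lemma sinc_prod_split u i : sinc_prod u =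
  \prod_(k | k != i) sinc ((u i - u k) / 2) *
  \prod_(j | j != i) \prod_(k | (k != i) && (j < k)%N) sinc ((u j - u k) / 2).
Proof.
exact: (@prod_pairs_split _ _ (fun j k => sinc ((u j - u k) / 2)) predT i (sinc_subC u)).
Qed.

Lemma sinc_prod_neq0 u : (forall j k, j != k -> sin ((u j - u k) / 2) != 0) ->
  sinc_prod u != 0.
Proof.
move=> H; apply/prodf_neq0 => j _; apply/prodf_neq0 => k jk.
by apply/sin_eq0_sinc/H; rewrite -val_eqE /= ltn_eqF.
Qed.

Lemma norm_prod_sinc_le1 (I : finType) (P : pred I) (f : I -> R) :
  (forall i, P i -> `|f i| <= 1) -> `|\prod_(i | P i) f i| <= 1.
Proof.
move=> H; rewrite normr_prod .
rewrite -[leRHS](_ : \prod_(i | P i) (1 : R) = 1); last by rewrite big1.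
by apply: ler_prod => i /H ->; rewrite normr_ge0.
Qed.

Lemma sinc_ge0 t : `|t| <= pi -> 0 <= sinc t.
Proof.
rewrite -sinc_norm; move: `|t| (normr_ge0 t) => {}t t0 tp.
rewrite /sinc; case: eqP => // _; by rewrite divr_ge0 // sin_ge0_pi // t0 tp.
Qed.

Lemma sinc_prod_ge u : (2 <= n)%N -> - (4 / pi ^+ 2) ^+ (n - 2) <= sinc_prod u.
Proof.
move=> n2; have q0 : 0 <= 4 / pi ^+ 2 :> R by rewrite divr_ge0 // exprn_ge0 // pi_ge0.
have [G0|G0] := leP 0 (sinc_prod u).
  by rewrite (le_trans _ G0) // oppr_le0 exprn_ge0.
have [i [j [ij sij]]] : exists i j, i != j /\ pi < `|(u i - u j) / 2|.
  apply: contrapT => H; move: G0; apply/negP; rewrite -leNgt.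
  apply: prodr_ge0 => j _; apply: prodr_ge0 => k jk; apply: sinc_ge0.
  rewrite leNgt; apply/negP => c; apply: H; exists j, k; split => //.
  by rewrite -val_eqE /= ltn_eqF.
rewrite lerNl -ltr0_norm // (sinc_prod_split u i) normrM.
rewrite (bigD1 j) 1?eq_sym //= normrM.
(* The factors through [j] are split off among the indices other than [i], so that the two families
   indexed by [k] can be multiplied termwise. *)
have -> : \prod_(j0 < n | j0 != i) \prod_(k < n | (k != i) && (j0 < k)%N) sinc ((u j0 - u k) / 2) =
   \prod_(k | (k != i) && (k != j)) sinc ((u j - u k) / 2) *
  \prod_(l | (l != i) && (l != j)) \prod_(k | ((k != i) && (k != j)) && (l < k)%N)
     sinc ((u l - u k) / 2).
  apply: (@prod_pairs_split _ _ (fun j k => sinc ((u j - u k) / 2)) (fun k => k != i) j (sinc_subC u)).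
  by rewrite eq_sym.
rewrite normrM mulrA -[leRHS]mulr1 ler_pM ?mulr_ge0 //; last first.
  by apply: norm_prod_sinc_le1 => l _; apply: norm_prod_sinc_le1 => k _; exact: norm_sinc_le1.
rewrite -mulrA -[leRHS]mul1r ler_pM ?mulr_ge0 ?norm_sinc_le1 //.
rewrite !normr_prod -big_split /=.
have -> : (n - 2)%N = #|[pred k : 'I_n | (k != i) && (k != j)]|.
  have := cardC (pred2 i j); rewrite card2 ij card_ord /= => /(congr1 (subn^~ 2)).
  by rewrite addKn => <-; apply: eq_card => k; rewrite !inE negb_or.
rewrite -prodr_const; apply: ler_prod => k _; rewrite mulr_ge0 //= sinc_pair_le //.
rewrite (le_trans (ltW sij)) //.
have -> : (u i - u j) / 2 = (u i - u k) / 2 - (u j - u k) / 2 by ring.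
exact: ler_normB.
Qed.

End Sinc.

(** * First order expansions of complex functions *)

Section ComplexNorm.
Variable R : realType.
Implicit Types (z w : R[i]) (s t : R).

Lemma complex_ext z w : complex.Re z = complex.Re w -> complex.Im z = complex.Im w -> z = w.
Proof. by case: z => a b; case: w => c d /= -> ->. Qed.

Lemma Re_mul z w : complex.Re (z * w) =
  complex.Re z * complex.Re w - complex.Im z * complex.Im w.
Proof. by case: z => ? ?; case: w. Qed.

Lemma Im_mul z w : complex.Im (z * w) =
  complex.Re z * complex.Im w + complex.Im z * complex.Re w.
Proof. by case: z => ? ?; case: w. Qed.

Lemma Re_add z w : complex.Re (z + w) = complex.Re z + complex.Re w.
Proof. by case: z => ? ?; case: w. Qed.

Lemma Im_add z w : complex.Im (z + w) = complex.Im z + complex.Im w.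
Proof. by case: z => ? ?; case: w. Qed.

Lemma Re_opp z : complex.Re (- z) = - complex.Re z.
Proof. by case: z. Qed.

Lemma Im_opp z : complex.Im (- z) = - complex.Im z.
Proof. by case: z. Qed.

Lemma normc_ge0 z : 0 <= normc z.
Proof. by case: z => a b; rewrite /normc sqrtr_ge0. Qed.

Lemma normcR t : normc t%:C = `|t|.
Proof. by rewrite /normc /= expr0n addr0 sqrtr_sqr. Qed.

Lemma real_complexB s t : s%:C - t%:C = (s - t)%:C.
Proof. by rewrite rmorphB. Qed.

Lemma real_complexM s t : s%:C * t%:C = (s * t)%:C.
Proof. by rewrite rmorphM. Qed.

Lemma real_complexD s t : s%:C + t%:C = (s + t)%:C.
Proof. by rewrite rmorphD. Qed.

Lemma real_complexN s : - s%:C = (- s)%:C.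
Proof. by rewrite rmorphN. Qed.

Lemma norm_Re_le z : `|complex.Re z| <= normc z.
Proof.
by case: z => a b /=; rewrite -sqrtr_sqr ler_wsqrtr // lerDl sqr_ge0.
Qed.

Lemma norm_Im_le z : `|complex.Im z| <= normc z.
Proof.
by case: z => a b /=; rewrite -sqrtr_sqr ler_wsqrtr // lerDr sqr_ge0.
Qed.

Lemma normc_le z : normc z <= `|complex.Re z| + `|complex.Im z|.
Proof.
rewrite {1}(complexE z) (le_trans (le_normcD _ _)) // normcM !normcR lerD2l.
by rewrite /normc /= expr0n add0r expr1n sqrtr1 mul1r.
Qed.

Lemma normc_i : normc ('i : R[i]) = 1.
Proof. by rewrite /normc /= expr0n add0r expr1n sqrtr1. Qed.

Lemma normc_sum I (r : seq I) (P : pred I) (f : I -> R[i]) :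
  normc (\sum_(i <- r | P i) f i) <= \sum_(i <- r | P i) normc (f i).
Proof.
elim/big_rec2: _ => [|i y x _ H]; first by rewrite normc0.
by rewrite (le_trans (le_normcD _ _)) // lerD2l.
Qed.

Definition expi t : R[i] := cos t +i* sin t.

Lemma expi0 : expi 0 = 1.
Proof. by rewrite /expi cos0 sin0. Qed.

Lemma expiD s t : expi (s + t) = expi s * expi t.
Proof.
apply: complex_ext; rewrite ?Re_mul ?Im_mul /= ?cosD ?sinD //.
by rewrite addrC.
Qed.

Lemma normc_expi s : normc (expi s) = 1.
Proof. by rewrite /normc /= cos2Dsin2 sqrtr1. Qed.

Lemma expi_neq0 s : expi s != 0.
Proof.
by apply/eqP => H; have := normc_expi s; rewrite H normc0 => /eqP; rewrite eq_sym oner_eq0.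
Qed.

Lemma expi_mulrn s n : expi (n%:R * s) = expi s ^+ n.
Proof.
by elim: n => [|n IH]; rewrite ?mul0r ?expi0 // mulrSr mulrDl mul1r expiD IH exprSr.
Qed.

Lemma expi_taylor t : normc (expi t - 1 - 'i * t%:C) <= 2 * t ^+ 2.
Proof.
have -> : expi t - 1 - 'i * t%:C = (cos t - 1) +i* (sin t - t).
  by apply: complex_ext; rewrite /= ?mul0r ?mul1r ?oppr0 ?addr0 ?subr0 ?add0r.
apply: (le_trans (normc_le _)) => /=.
have := norm_cosB1_le t; have := norm_sinB_le t; have := sqr_ge0 t; lra.
Qed.

End ComplexNorm.

Section FirstOrder.
Variables (R : realType) (T : Type) (D : T -> Prop) (h : T -> R).
Hypothesis h1 : forall i, D i -> `|h i| <= 1.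
Implicit Types f g : T -> R[i].

Definition bnd f := exists C, forall i, D i -> normc (f i) <= C.

(* [f' = f + h f1 + O(h^2)], uniformly on [D]. *)
Definition approx f' f f1 := exists C, forall i, D i ->
  normc (f' i - f i - (h i)%:C * f1 i) <= C * h i ^+ 2.

Lemma bndD f g : bnd f -> bnd g -> bnd (fun i => f i + g i).
Proof.
move=> [C HC] [C' HC']; exists (C + C') => i Di.
by rewrite (le_trans (le_normcD _ _)) // lerD ?HC ?HC'.
Qed.

Lemma bndM f g : bnd f -> bnd g -> bnd (fun i => f i * g i).
Proof.
move=> [C HC] [C' HC']; exists (C * C') => i Di.
by rewrite normcM ler_pM ?normc_ge0 ?HC ?HC'.
Qed.

Lemma bnd_cst c : bnd (fun=> c).
Proof. by exists (normc c). Qed.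

Lemma approx_cst f : approx f f (fun=> 0).
Proof.
exists 0 => i _; rewrite subrr mulr0 subrr mul0r.
by rewrite normc0.
Qed.

Lemma approxD f' f f1 g' g g1 : approx f' f f1 -> approx g' g g1 ->
  approx (fun i => f' i + g' i) (fun i => f i + g i) (fun i => f1 i + g1 i).
Proof.
move=> [C HC] [C' HC']; exists (C + C') => i Di; rewrite mulrDl.
apply: le_trans (lerD (HC i Di) (HC' i Di)).
rewrite [X in normc X <= _](_ : _ =
  (f' i - f i - (h i)%:C * f1 i) + (g' i - g i - (h i)%:C * g1 i)); last by ring.
exact: le_normcD.
Qed.

Lemma approx_ext f' f f1 g' g g1 :
  (forall i, D i -> [/\ g' i = f' i, g i = f i & g1 i = f1 i]) ->
  approx f' f f1 -> approx g' g g1.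
Proof.
move=> E [C HC]; exists C => i Di.
by have [-> -> ->] := E i Di; exact: HC.
Qed.

(** As [|h| <= 1], the remainder in [h^2] is absorbed by [|h|]. In the product and chain rules this
    makes products of two increments quadratic. *)
Lemma approx_lip f' f f1 : bnd f1 -> approx f' f f1 ->
  exists2 C, 0 <= C & forall i, D i -> normc (f' i - f i) <= C * `|h i|.
Proof.
move=> [B HB] [C HC]; exists (`|B| + `|C|) => [|i Di]; first by rewrite addr_ge0.
rewrite (_ : f' i - f i = (f' i - f i - (h i)%:C * f1 i) + (h i)%:C * f1 i); last by ring.
apply: (le_trans (le_normcD _ _)); rewrite normcM normcR.
have := HB i Di; have := HC i Di; have := ler_norm B; have := ler_norm C.
have := h1 Di; have := normr_ge0 (h i); rewrite -(real_normK (num_real (h i))).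
set H := `|h i|; set a := normc _; set b := normc _ => *.
rewrite mulrDl addrC lerD //; first by rewrite mulrC ler_wpM2r //; lra.
have : C * H ^+ 2 <= `|C| * H.
  rewrite expr2 mulrA; apply: (@le_trans _ _ (`|C| * H * H)).
    by rewrite ler_wpM2r // ler_wpM2r.
  by rewrite ler_piMr // mulr_ge0.
lra.
Qed.

Lemma approxM f' f f1 g' g g1 : bnd f -> bnd f1 -> bnd g -> bnd g1 ->
  approx f' f f1 -> approx g' g g1 ->
  approx (fun i => f' i * g' i) (fun i => f i * g i)
    (fun i => f1 i * g i + f i * g1 i).
Proof.
move=> [Bf Hf] bf1 [Bg Hg] bg1 af ag.
have [Lf Lf0 HLf] := approx_lip bf1 af; have [Lg Lg0 HLg] := approx_lip bg1 ag.
case: af ag => [C HC] [C' HC']; exists (Lf * Lg + C * Bg + Bf * C') => i Di.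
rewrite [X in normc X <= _](_ : _ = (f' i - f i) * (g' i - g i) +
  (f' i - f i - (h i)%:C * f1 i) * g i + f i * (g' i - g i - (h i)%:C * g1 i)); last by ring.
rewrite (le_trans (le_normcD _ _)) // [leRHS]mulrDl lerD //; last first.
  by rewrite normcM -mulrA ler_pM ?normc_ge0 ?Hf ?HC'.
rewrite (le_trans (le_normcD _ _)) // [leRHS]mulrDl lerD //; last first.
  by rewrite normcM mulrAC ler_pM ?normc_ge0 ?Hg ?HC.
rewrite normcM -(real_normK (num_real (h i))) expr2 mulrACA.
by rewrite ler_pM ?normc_ge0 ?HLf ?HLg.
Qed.

Lemma approxZ c f' f f1 : approx f' f f1 ->
  approx (fun i => c * f' i) (fun i => c * f i) (fun i => c * f1 i).
Proof.
move=> [C HC]; exists (normc c * C) => i Di.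
rewrite [X in normc X <= _](_ : _ = c * (f' i - f i - (h i)%:C * f1 i)); last by ring.
by rewrite normcM -mulrA ler_wpM2l ?normc_ge0 ?HC.
Qed.

Lemma approx_sum (I : Type) (r : seq I) (P : pred I) (f' f f1 : I -> T -> R[i]) :
  (forall k, P k -> approx (f' k) (f k) (f1 k)) ->
  approx (fun i => \sum_(k <- r | P k) f' k i) (fun i => \sum_(k <- r | P k) f k i)
    (fun i => \sum_(k <- r | P k) f1 k i).
Proof.
move=> H; elim: r => [|k r IH].
  apply: approx_ext (approx_cst (fun=> 0)) => i _; by rewrite !big_nil.
have [Pk|Pk] := boolP (P k).
  by apply: approx_ext (approxD (H k Pk) IH) => i _; rewrite !big_cons Pk.
by apply: approx_ext IH => i _; rewrite !big_cons (negbTE Pk).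
Qed.

Lemma approx_Re f' f f1 : approx f' f f1 ->
  approx (fun i => (complex.Re (f' i))%:C) (fun i => (complex.Re (f i))%:C)
    (fun i => (complex.Re (f1 i))%:C).
Proof.
move=> [C HC]; exists C => i Di; apply: le_trans (HC i Di).
apply: (le_trans _ (norm_Re_le _)).
rewrite real_complexM !real_complexB normcR !Re_add !Re_opp Re_mul /= mul0r subr0 //.
Qed.

(** After the unimodular [expi (s i)] is factored out, Taylor's bound applies to the increment of
    [s], whose square is [O(h^2)]. *)
Lemma approx_expi (s' s s1 : T -> R) : bnd (fun i => (s1 i)%:C) ->
  approx (fun i => (s' i)%:C) (fun i => (s i)%:C) (fun i => (s1 i)%:C) ->
  approx (fun i => expi (s' i)) (fun i => expi (s i)) (fun i => 'i * (s1 i)%:C * expi (s i)).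
Proof.
move=> b1 a; have [L L0 HL] := approx_lip b1 a.
case: a => C HC; exists (2 * L ^+ 2 + C) => i Di.
have := HL i Di; have {HC} := HC i Di.
rewrite real_complexM !real_complexB !normcR => H1 H2.
pose d := s' i - s i.
rewrite (_ : s' i = s i + d); last by rewrite /d addrC subrK.
rewrite expiD [X in normc X <= _](_ : _ = expi (s i) * (expi d - 1 - 'i * d%:C) +
  expi (s i) * 'i * (d - h i * s1 i)%:C); last by rewrite -real_complexB -real_complexM; ring.
rewrite (le_trans (le_normcD _ _)) // !normcM !normc_expi normc_i !mul1r normcR mulrDl lerD //.
rewrite (le_trans (expi_taylor d)) // -mulrA ler_pM2l // -(real_normK (num_real d)).
by rewrite -(real_normK (num_real (h i))) -exprMn lerXn2r ?nnegrE // mulr_ge0.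
Qed.

End FirstOrder.

Section ComplexDerivative.
Variable R : realType.
Implicit Types u v : R -> R[i].

(** A derivative with quadratic remainder, the constant being free to depend on [t]: uniform
    estimates of means give this form directly. *)
Definition cder u u' := forall t, approx (fun h : R => `|h| <= 1) id
  (fun h => u (t + h)) (fun=> u t) (fun=> u' t).

Lemma cder_cst c : cder (fun=> c) (fun=> 0).
Proof. by move=> t; apply: approx_cst. Qed.

Lemma cderD u u' v v' : cder u u' -> cder v v' ->
  cder (fun t => u t + v t) (fun t => u' t + v' t).
Proof. by move=> H1 H2 t; apply: approxD. Qed.

Lemma cderZ c u u' : cder u u' -> cder (fun t => c * u t) (fun t => c * u' t).
Proof. by move=> H1 t; apply: approxZ. Qed.

Lemma cderM u u' v v' : cder u u' -> cder v v' ->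
  cder (fun t => u t * v t) (fun t => u' t * v t + u t * v' t).
Proof.
move=> H1 H2 t.
exact: (approxM (D := fun h : R => `|h| <= 1) (fun i Di => Di) (bnd_cst _ (u t))
  (bnd_cst _ _) (bnd_cst _ _) (bnd_cst _ _) (H1 t) (H2 t)).
Qed.

Lemma cder_ext u u' v v' : u =1 v -> u' =1 v' -> cder u u' -> cder v v'.
Proof. by move=> E E' H t; apply: approx_ext (H t) => i _; rewrite !E E'. Qed.

Lemma cder_id : cder (fun t => t%:C) (fun=> 1).
Proof.
move=> t; exists 0 => h _; rewrite mulr1 !real_complexB [t + h]addrC addrK subrr normc0.
by rewrite mul0r.
Qed.

Lemma cder_expi (l : R) : cder (fun t => expi (l * t)) (fun t => 'i * l%:C * expi (l * t)).
Proof.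
move=> t; apply: (@approx_expi R R (fun h => `|h| <= 1) id (fun i Di => Di)
  (fun h => l * (t + h)) (fun=> l * t) (fun=> l)) => /=.
  exact: bnd_cst.
exists 0 => h _; rewrite real_complexM !real_complexB normcR mul0r.
by rewrite (_ : _ - _ = 0) ?normr0 //; ring.
Qed.

(** The difference quotient is at most a multiple of [|h|], so the derivative vanishes
    everywhere. *)
Lemma quad_is_cst (f : R -> R) :
  (forall t, exists C, forall h, `|h| <= 1 -> `|f (t + h) - f t| <= C * h ^+ 2) ->
  forall x y, f x = f y.
Proof.
move=> H x y; apply: is_derive_0_is_cst => t.
have [C HC] := H t.
have D : h^-1 *: ((f \o shift t) (h *: (1 : R)) - f t) @[h --> 0^'] --> (0 : R).
  apply/cvgrPdist_le => e e0; near=> h.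
  have h0 : h != 0 by near: h; exact: nbhs_dnbhs_neq.
  have h1 : `|h| <= 1.
    near: h; apply: dnbhs0_le => //.
  have h2 : (`|C| + 1) * `|h| <= e.
    rewrite -ler_pdivlMl; last by rewrite ltr_wpDl.
    near: h; apply: dnbhs0_le; by rewrite mulr_gt0 // invr_gt0 ltr_wpDl.
  rewrite sub0r normrN /= normrM normfV.
  rewrite ler_pdivrMl ?normr_gt0 // [h *: 1]mulr1.
  rewrite [h + t]addrC (le_trans (HC h h1)) // -(real_normK (num_real h)) expr2 mulrCA.
  rewrite ler_wpM2l // (le_trans _ h2) // ler_wpM2r //.
  by rewrite (le_trans (ler_norm C)) // lerDl.
apply: DeriveDef; first by apply/cvg_ex; exists 0.
exact: cvg_lim D.
Unshelve. all: by end_near. Qed.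

Lemma cder0_cst u : cder u (fun=> 0) -> forall x y, u x = u y.
Proof.
move=> H x y; apply: complex_ext.
- apply: (@quad_is_cst (fun t => complex.Re (u t))) => t.
  have [C HC] := H t; exists C => h h1; apply: le_trans (HC h h1).
  rewrite mulr0 subr0 /= -Re_opp -Re_add; exact: norm_Re_le.
- apply: (@quad_is_cst (fun t => complex.Im (u t))) => t.
  have [C HC] := H t; exists C => h h1; apply: le_trans (HC h h1).
  rewrite mulr0 subr0 /= -Im_opp -Im_add; exact: norm_Im_le.
Qed.

(** Integrating factor: [u] times [expi (- l * t)] has derivative zero. *)
Lemma cder_eigen (l : R) u : cder u (fun t => 'i * l%:C * u t) ->
  forall t, u t = u 0 * expi (l * t).
Proof.
move=> H t.
have D : cder (fun t => u t * expi (- l * t)) (fun=> 0).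
  apply: cder_ext (cderM H (@cder_expi (- l))) => // x.
  by rewrite rmorphN /=; ring.
have := cder0_cst D t 0; rewrite mulr0 expi0 mulr1 => <-.
by rewrite -mulrA -expiD mulNr addNr expi0 mulr1.
Qed.

End ComplexDerivative.

(** * Characteristic matrices of principal submatrices *)

Section TwistedDerivation.
Variables (K : comNzRingType) (I : eqType) (c : K) (y : I -> K).
Implicit Types (p q : {poly K}) (s : seq I) (k : I).

(** The operator [y k - c d/dX] has constant coefficients, so all of these commute with one another
    and with the derivative. The order of the list in [twists] is therefore immaterial, and any [k]
    can be brought to its head. *)
Definition twist k p := y k *: p - c *: p^`().

Definition twists s p := foldr twist p s.

Lemma twistD k p q : twist k (p + q) = twist k p + twist k q.
Proof. by rewrite /twist derivD !scalerDr opprD addrACA. Qed.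

Lemma twistZ k a p : twist k (a *: p) = a *: twist k p.
Proof. by rewrite /twist derivZ scalerBr !scalerA ![a * _]mulrC. Qed.

Lemma twist_deriv k p : twist k p^`() = (twist k p)^`().
Proof. by rewrite /twist derivB !derivZ. Qed.

Lemma twistC j k p : twist j (twist k p) = twist k (twist j p).
Proof.
by rewrite /twist !derivB !derivZ -!mul_polyC; ring.
Qed.

Lemma twistsD s p q : twists s (p + q) = twists s p + twists s q.
Proof. by elim: s => //= k s ->; rewrite twistD. Qed.

Lemma twistsZ s a p : twists s (a *: p) = a *: twists s p.
Proof. by elim: s => //= k s ->; rewrite twistZ. Qed.

Lemma twistsN s p : twists s (- p) = - twists s p.
Proof. by rewrite -scaleN1r twistsZ scaleN1r. Qed.

Lemma twists0 s : twists s 0 = 0.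
Proof. by rewrite -[X in twists s X](scale0r 0) twistsZ scale0r. Qed.

Lemma twists_sum s (J : Type) (r : seq J) (P : pred J) (f : J -> {poly K}) :
  twists s (\sum_(j <- r | P j) f j) = \sum_(j <- r | P j) twists s (f j).
Proof. exact: (big_morph _ (twistsD s) (twists0 s)). Qed.

Lemma twists_deriv s p : twists s p^`() = (twists s p)^`().
Proof. by elim: s => //= k s ->; rewrite twist_deriv. Qed.

Lemma twists_rem s k p : k \in s -> twists s p = twist k (twists (rem k s) p).
Proof.
elim: s => //= j s IH; rewrite inE eq_sym; have [-> //|jk /= ks] := eqVneq j k.
by rewrite IH //= twistC.
Qed.

Lemma twist_XsubC k a q : twist k (('X - a%:P) * q) = ('X - a%:P) * twist k q - c *: q.
Proof.
by rewrite /twist derivM derivXsubC -!mul_polyC; ring.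
Qed.

(** The commutator of one twist with ['X - a] is the scalar [- c]; moving a whole product past
    ['X - a] leaves one term for each factor dropped. At [a] only these terms survive. *)
Lemma twists_XsubC s a q : uniq s -> twists s (('X - a%:P) * q) =
  ('X - a%:P) * twists s q - c *: \sum_(k <- s) twists (rem k s) q.
Proof.
elim: s => [|j s IH] /=; first by rewrite big_nil scaler0 subr0.
move=> /andP[js us]; rewrite IH // twistD -scaleNr twistZ twist_XsubC scaleNr.
rewrite big_cons eqxx [in RHS]scalerDr opprD addrA.
congr (_ + - (c *: _)); rewrite (big_morph _ (twistD j) (twists0 [:: j])) /= big_seq [RHS]big_seq; apply: eq_bigr => k ks.
by case: eqVneq ks js => // -> ->.
Qed.

Lemma size_twists s p : (size (twists s p) <= size p)%N.
Proof.
elim: s => //= k s /(leq_trans _); apply.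
rewrite (leq_trans (size_polyD _ _)) // geq_max size_scale_leq size_polyN.
rewrite /= (leq_trans (size_scale_leq _ _)) //; have [->|p0] := eqVneq (twists s p) 0.
  by rewrite deriv0.
by rewrite ltnW // lt_size_deriv.
Qed.

Lemma coef_twist k p m : (twist k p)`_m = y k * p`_m - c * (m.+1%:R * p`_m.+1).
Proof. by rewrite coefB !coefZ coef_deriv mulr_natl. Qed.

End TwistedDerivation.

Section PrincipalMinor.
Variables (K : fieldType) (n : nat).
Implicit Types (S : pred 'I_n) (b R V : 'M[K]_n).

(* The characteristic matrix of the principal submatrix of [b] on [S], bordered by
   an identity block so that all [S] share one matrix size. *)
Definition pcm S b : 'M[{poly K}]_n := \matrix_(i, j)
  if S i && S j then 'X *+ (i == j) - (b i j)%:P else (i == j)%:R.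

Lemma eq_pcm S S' b : S =1 S' -> pcm S b = pcm S' b.
Proof. by move=> E; apply/matrixP => i j; rewrite !mxE !E. Qed.

Lemma pcmT S b : (forall i, S i) -> pcm S b = char_poly_mx b.
Proof. by move=> ST; apply/matrixP => i j; rewrite !mxE !ST. Qed.

Definition proj_mx S : 'M[{poly K}]_n := diag_mx (\row_i (S i)%:R).

Lemma pcmE S b : pcm S b =
  proj_mx S *m char_poly_mx b *m proj_mx S + (1%:M - proj_mx S).
Proof.
apply/matrixP => i j; rewrite mul_mx_diag mul_diag_mx !mxE.
by have [<-|ij] := eqVneq i j; case: (S i); case: (S j); rewrite /= ?mulr1n ?mulr0n; ring.
Qed.

(** Multiplying the rows outside [S] by ['X] gives the characteristic matrix of [b] truncated to
    [S], whose determinant is monic. *)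
Lemma det_pcm_neq0 S b : \det (pcm S b) != 0.
Proof.
pose Q : 'M[{poly K}]_n := diag_mx (\row_i (if S i then 1 else 'X)).
have H : Q *m pcm S b = char_poly_mx (\matrix_(i, j) (if S i && S j then b i j else 0)).
  apply/matrixP => i j; rewrite mul_diag_mx !mxE.
  have [<-|ij] := eqVneq i j; case: (S i) => /=; rewrite ?mul1r ?subr0 ?mulr1 //.
  by case: (S j); rewrite ?mulr0n ?subr0.
  by rewrite mulr0.
have : \det (char_poly_mx (\matrix_(i, j) (if S i && S j then b i j else 0))) != 0.
  by rewrite monic_neq0 // char_poly_monic.
by rewrite -H det_mulmx mulf_eq0 negb_or => /andP[].
Qed.

(** Both sides are [\det N] times the inverse of [P *m N *m Q]. Over polynomials this is expressed
    by multiplying out and cancelling the nonzero determinant. *)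
Lemma adj_conj (N P Q : 'M[{poly K}]_n) : \det N != 0 -> Q *m P = 1%:M ->
  \adj (P *m N *m Q) = P *m \adj N *m Q.
Proof.
move=> N0 QP; have PQ : P *m Q = 1%:M by exact: mulmx1C.
pose M := P *m N *m Q.
have dM : \det M = \det N.
  by rewrite /M -mulmxA det_mulmx mulrC det_mulmx -mulrA -det_mulmx QP det1 mulr1.
have : \adj M *m M *m (P *m \adj N *m Q) = (\det M)%:M *m (P *m \adj N *m Q).
  by rewrite mul_adj_mx.
have -> : \adj M *m M *m (P *m \adj N *m Q) = (\det M) *: \adj M.
  rewrite /M -!mulmxA (mulmxA Q) QP mul1mx (mulmxA N) mul_mx_adj.
  by rewrite mul_scalar_mx -!scalemxAr PQ mulmx1 !mulmxA -/M dM.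
rewrite mul_scalar_mx dM => /matrixP H; apply/matrixP => i j.
by have := H i j; rewrite !mxE => /(mulfI N0).
Qed.

(** The hypothesis makes [P] the identity outside the block of [S], so it commutes with the
    projection onto [S] and fixes the bordering block; its inverse [Q] inherits both properties. *)
Lemma pcm_conj S b P Q : Q *m P = 1%:M ->
  (forall i j, ~~ (S i && S j) -> P i j = (i == j)%:R) ->
  pcm S (P *m b *m Q) = map_mx polyC P *m pcm S b *m map_mx polyC Q.
Proof.
move=> QP HP; have PQ : P *m Q = 1%:M by exact: mulmx1C.
pose p := map_mx polyC P; pose q := map_mx polyC Q; pose D := proj_mx S.
have pq : p *m q = 1%:M by rewrite -map_mxM PQ map_mx1.
have pD : p *m D = D *m p.
  apply/matrixP => i j; rewrite mul_mx_diag mul_diag_mx !mxE.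
  case Si : (S i); case Sj : (S j); rewrite ?mul1r ?mul0r ?mulr1 ?mulr0 //.
  - rewrite HP ?Si ?Sj //; case: eqVneq => [ij|_]; last by rewrite polyC0.
    by move: Si; rewrite ij Sj.
  - rewrite HP ?Si ?Sj //; case: eqVneq => [ij|_]; last by rewrite polyC0.
    by move: Si; rewrite ij Sj.
have pD1 : p *m (1%:M - D) = 1%:M - D.
  apply/matrixP => i j; rewrite !mxE (bigD1 j) //= big1 => [|k kj].
    rewrite !mxE eqxx addr0 mulr1n.
    case Sj : (S j); first by rewrite subrr mulr0; case: eqVneq => [->|_]; rewrite ?mulr1n ?mulr0n ?Sj ?subrr ?subr0.
    rewrite HP ?Sj ?andbF // subr0 mulr1; case: eqVneq => [->|_]; rewrite ?Sj ?mulr1n ?mulr0n ?subr0 ?polyC0 //.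
  by rewrite !mxE (negbTE kj) mulr0n subr0 mulr0.
have qp : q *m p = 1%:M by exact: mulmx1C.
have qD : D *m q = q *m D.
  by rewrite -[RHS]mulmx1 -pq mulmxA -(mulmxA q D) -pD mulmxA qp mul1mx.
have qD1 : (1%:M - D) *m q = 1%:M - D.
  rewrite mulmxBl qD mul1mx -[q in q - _]mulmx1 -mulmxBr -pD1 mulmxA qp mul1mx.
  by rewrite pD1.
have Xc : p *m char_poly_mx b *m q = char_poly_mx (P *m b *m Q).
  rewrite /char_poly_mx mulmxBr mulmxBl !map_mxM -/p -/q; congr (_ - _).
  by rewrite scalar_mxC -mulmxA pq mulmx1.
rewrite !pcmE -/p -/q -/D -Xc mulmxDr mulmxDl pD1 qD1; congr (_ + _).
by rewrite !mulmxA pD -!mulmxA qD.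
Qed.

Lemma adj_pcm_conj S b P Q : Q *m P = 1%:M ->
  (forall i j, ~~ (S i && S j) -> P i j = (i == j)%:R) ->
  \adj (pcm S (P *m b *m Q)) =
  map_mx polyC P *m \adj (pcm S b) *m map_mx polyC Q.
Proof.
move=> QP HP; rewrite pcm_conj // adj_conj ?det_pcm_neq0 //.
by rewrite -map_mxM QP map_mx1.
Qed.

(** Laplace expansion along row [i0], with the diagonal term set apart: the other terms pair
    [b i0 k] with the adjugate entry [(k, i0)], the combination that invariance controls. *)
Lemma det_pcm_expand i0 s b : uniq (i0 :: s) ->
  let S := mem (i0 :: s) in
  \det (pcm S b) = ('X - (b i0 i0)%:P) * \adj (pcm S b) i0 i0 -
  \sum_(k <- s) (b i0 k)%:P * \adj (pcm S b) k i0.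
Proof.
move=> us S; rewrite (expand_det_row _ i0) (bigID S) /= addrC big1 ?add0r => [|j Sj]; last first.
  rewrite mxE; have /negbTE -> : ~~ S j by [].
  have -> : S i0 by rewrite /S /= inE eqxx.
  case: eqVneq Sj => [<-|_ _]; first by rewrite /S /= inE eqxx.
  by rewrite mul0r.
rewrite -(big_uniq _ us) big_cons; congr (_ + _).
  by rewrite !mxE /S /= !inE eqxx mulr1n.
rewrite -sumrN big_seq [RHS]big_seq; apply: eq_bigr => k ks.
have Sk : S k by rewrite /S /= inE ks orbT.
rewrite !mxE Sk /S /= inE eqxx /=; case: eqVneq us ks => [->|_ _ _].
  by rewrite cons_uniq => /andP[/negbTE ->].
by rewrite mulr0n sub0r mulNr.
Qed.

(** Deleting row and column [k] has the same determinant as replacing them by those of the identity;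
    the border thus turns a minor into a smaller principal submatrix. *)
Lemma adj_pcm_diag S b k : S k ->
  \adj (pcm S b) k k = \det (pcm (predD1 S k) b).
Proof.
move=> Sk; rewrite (expand_det_row _ k) (bigD1 k) //= big1 ?addr0 => [|j jk]; last first.
  by rewrite !mxE /= eqxx /= (eq_sym k) (negbTE jk) mul0r.
rewrite !mxE /= eqxx mul1r /cofactor; congr (_ * \det _).
apply/matrixP => i j; rewrite !mxE /=.
by rewrite !(eq_sym _ k) !neq_lift.
Qed.

End PrincipalMinor.

Lemma char_poly_conj (K : fieldType) n (P A : 'M[K]_n) : P \in unitmx ->
  char_poly (P *m A *m invmx P) = char_poly A.
Proof.
move=> uP; rewrite /char_poly -!(@pcmT _ _ predT) //.
rewrite pcm_conj ?mulVmx // !det_mulmx mulrAC -det_mulmx -map_mxM mulmxV //.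
by rewrite map_mx1 det1 mul1r.
Qed.

Lemma char_poly_diag (K : fieldType) n (d : 'rV[K]_n) :
  char_poly (diag_mx d) = \prod_i ('X - (d 0 i)%:P).
Proof.
rewrite char_poly_trig ?diag_mx_is_trig //.
by apply: eq_bigr => i _; rewrite mxE eqxx mulr1n.
Qed.

(** * Means over a coadjoint orbit *)

Section Orbit.
Variables (R : realType) (n : nat) (l : 'rV[R]_n).
Local Notation C := R[i].
Local Notation M := 'M[C]_n.

Definition orbit_poly : {poly C} := \prod_i ('X - ((l 0 i)%:C)%:P).

Lemma char_poly_cartan : char_poly (cartan_mx l) = orbit_poly.
Proof. by rewrite char_poly_diag; apply: eq_bigr => i _; rewrite mxE. Qed.

Lemma cartan_herm : (cartan_mx l)^t* = cartan_mx l.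
Proof.
apply/matrixP => i j; rewrite !mxE eq_sym; case: eqVneq => [->|_].
  by rewrite !mulr1n; apply: conjc_real.
by rewrite !mulr0n rmorph0.
Qed.

(** An [n]-th root of the inverse determinant corrects the determinant; it has modulus one, and
    conjugation does not see a scalar. *)
Lemma unitarymx_rescale (U : M) : (0 < n)%N -> U \is unitarymx ->
  exists2 c : C, c * c^* = 1 & c ^+ n * \det U = 1.
Proof.
move=> n0 uU.
have dU : `|\det U| = 1.
  have /(congr1 determinant) := unitarymxP uU.
  rewrite det_mulmx det1 det_map_mx det_tr -normCK => /eqP.
  by rewrite sqrp_eq1 // => /eqP.
have dU0 : \det U != 0 by rewrite -normr_eq0 dU oner_eq0.
exists (n.-root (\det U)^-1); last by rewrite rootCK // mulVf.
have /eqP : `|n.-root (\det U)^-1| ^+ n = 1 by rewrite -normrX rootCK // normfV dU invr1.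
rewrite pexpr_eq1 // => /eqP H.
by have := normCK (n.-root (\det U)^-1); rewrite H expr1n.
Qed.

(** The spectral theorem describes the orbit by equations. These give its measurability, the
    constancy of the characteristic polynomial and the reality of the diagonal. *)
Lemma orbitP (b : M) : (0 < n)%N ->
  orbit_SU l b <-> b^t* = b /\ char_poly b = orbit_poly.
Proof.
move=> n0; split.
  move=> [U [uU _] <-]; rewrite /coadjoint; split.
    rewrite invmx_unitary // !trmx_mul !map_mxM trmxCK cartan_herm.
    by rewrite mulmxA.
  by rewrite char_poly_conj ?unitarymx_unit // char_poly_cartan.
move=> [hb cb].
have nb : b \is normalmx by apply/normalmxP; rewrite hb.
have /orthomx_spectral_subproof[[P d] /= uP Eb] := nb.
(* Equal products of linear factors match the eigenvalues [d] with [l] up to a permutation, which is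
   then absorbed into the unitary matrix [V]. *)
have cd : \prod_(x <- [tuple d 0 i | i < n]) ('X - x%:P) =
          \prod_(x <- [tuple (l 0 i)%:C | i < n]) ('X - x%:P).
  rewrite !big_tuple; under eq_bigr do rewrite tnth_mktuple.
  under [RHS]eq_bigr do rewrite tnth_mktuple.
  rewrite -char_poly_diag -[RHS]cb [in RHS]Eb -[X in _ *m X](invmxK P).
  by rewrite char_poly_conj ?unitmx_inv ?unitarymx_unit.
have /tuple_permP[s Es] := prod_XsubC_eq cd.
have ds i : d 0 i = (l 0 (s i))%:C.
  have := congr1 (fun t => nth 0 t i) Es.
  rewrite -!tnth_nth !tnth_mktuple.
  exact.
have EP := invmx_unitary uP; have uQ : P^t* \is unitarymx by rewrite trmxC_unitary.
pose V := P^t* *m perm_mx s.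
have uV : V \is unitarymx.
  apply: (mul_unitarymx uQ).
  by apply/unitarymxP; rewrite tr_perm_mx map_perm_mx -perm_mxM mulgV perm_mx1.
have EV : b = V *m cartan_mx l *m invmx V.
  rewrite Eb (invmx_unitary uV) /V trmx_mul map_mxM trmxCK EP.
  rewrite tr_perm_mx map_perm_mx.
  rewrite !mulmxA; congr (_ *m _); rewrite -!mulmxA; congr (_ *m _).
  rewrite mulmxA -row_permE -col_permE; apply/matrixP => i j; rewrite !mxE.
  by rewrite (inj_eq perm_inj) ds.
have [c c1 cn] := unitarymx_rescale n0 uV.
have c0 : c != 0 by apply/eqP => E; move/eqP: c1; rewrite E mul0r eq_sym oner_eq0.
have ucV : c *: V \is unitarymx.
  apply/unitarymxP; rewrite linearZ /= map_mxZ -scalemxAl -scalemxAr scalerA c1 scale1r.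
  exact: unitarymxP.
exists (c *: V); first by split => //; rewrite detZ.
rewrite /coadjoint invmxZ ?unitarymx_unit // -!scalemxAl -scalemxAr scalerA mulfV // scale1r.
by rewrite -EV.
Qed.

Lemma orbit_diag_real (b : M) i : (0 < n)%N -> orbit_SU l b ->
  b i i = (complex.Re (b i i))%:C.
Proof.
move=> n0 /orbitP[] // /matrixP/(_ i i); rewrite !mxE => H _.
case: (b i i) H => x y [] yN. apply: complex_ext => //=; lra.
Qed.

Lemma unitarymx_entry (U : M) i j : U \is unitarymx -> normc (U i j) <= 1.
Proof.
move=> /unitarymxP/matrixP/(_ i i); rewrite !mxE eqxx => H.
have : `|U i j| ^+ 2 <= 1.
  rewrite -[leRHS]H (bigD1 j) //= !mxE -normCK lerDl sumr_ge0 // => k _.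
  by rewrite !mxE -normCK exprn_ge0.
rewrite (_ : `|U i j| = (normc (U i j))%:C); last by case: (U i j).
by rewrite -rmorphXn /= lecR expr_le1 // normc_ge0.
Qed.

Lemma orbit_bnd i j : bnd (orbit_SU l) (fun b : M => b i j).
Proof.
exists (\sum_k `|l 0 k|) => b [U [uU _] <-]; rewrite /coadjoint invmx_unitary // mxE.
apply: (le_trans (normc_sum _ _ _)); apply: ler_sum => k _.
rewrite mul_mx_diag !mxE !normcM normcR mulrAC -[leRHS]mul1r.
rewrite ler_pM ?mulr_ge0 ?normc_ge0 // ?mulr_ile1 ?normc_ge0 ?unitarymx_entry //.
by have /(unitarymx_entry j k) := uU; case: (U j k) => x y; rewrite /normc /= sqrrN.
Qed.

End Orbit.

(** * Polynomial expressions in functions of a given class *)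

Section FunctionSubring.
Variables (K : fieldType) (T : Type) (A : (T -> K) -> Prop).

(** Closure conditions on an abstract class [A]: the same expressions in the matrix entries have to
    be shown measurable, bounded, or both. *)
Definition fun_subring := [/\ forall c, A (fun=> c),
  forall f g, A f -> A g -> A (fun x => f x + g x) &
  forall f g, A f -> A g -> A (fun x => f x * g x)].

Hypothesis HA : fun_subring.

Lemma subring_sum I (r : seq I) (P : pred I) (f : I -> T -> K) :
  (forall i, P i -> A (f i)) -> A (fun x => \sum_(i <- r | P i) f i x).
Proof.
have [Ac Ad Am] := HA; move=> H; elim: r => [|i r IH].
  by under eq_fun do rewrite big_nil; exact: Ac.
under eq_fun do rewrite big_cons; have [Pi|_] := boolP (P i); last exact: IH.
exact: Ad (H i Pi) IH.
Qed.

Lemma subring_scale c f : A f -> A (fun x => c * f x).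
Proof. by have [Ac _ Am] := HA; move=> H; apply: Am. Qed.

Lemma subring_sub f g : A f -> A g -> A (fun x => f x - g x).
Proof.
have [Ac Ad Am] := HA; move=> Hf Hg; apply: Ad => //.
under eq_fun do rewrite -mulN1r; exact: Am.
Qed.

Lemma subring_pow f m : A f -> A (fun x => f x ^+ m).
Proof.
have [Ac _ Am] := HA; move=> H; elim: m => [|m IH]; first exact: Ac.
under eq_fun do rewrite exprS; exact: Am.
Qed.

Definition coef_in (p : T -> {poly K}) := forall m, A (fun x => (p x)`_m).

Lemma coef_in_subring : (forall c, coef_in (fun=> c)) /\
  (forall p q, coef_in p -> coef_in q -> coef_in (fun x => p x * q x)).
Proof.
have [Ac Ad Am] := HA; split=> [c m|p q Hp Hq m]; first exact: Ac.
under eq_fun do rewrite coefM.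
by apply: subring_sum => i _; apply: Am.
Qed.

Lemma coef_in_prod I (r : seq I) (f : I -> T -> {poly K}) :
  (forall i, coef_in (f i)) -> coef_in (fun x => \prod_(i <- r) f i x).
Proof.
have [Hc HM] := coef_in_subring; move=> H; elim: r => [|i r IH].
  by under eq_fun do rewrite big_nil; exact: Hc.
by under eq_fun do rewrite big_cons; exact: HM.
Qed.

Lemma coef_in_det n (F : T -> 'M[{poly K}]_n) :
  (forall i j, coef_in (fun x => F x i j)) -> coef_in (fun x => \det (F x)).
Proof.
move=> H m; rewrite /determinant; under eq_fun do rewrite coef_sum.
apply: subring_sum => s _; have [Hc HM] := coef_in_subring.
apply: (HM (fun=> _) (fun x => \prod_i F x i (s i))); first exact: Hc.
exact: coef_in_prod.
Qed.

Lemma coef_in_adj n (F : T -> 'M[{poly K}]_n) i j :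
  (forall i j, coef_in (fun x => F x i j)) -> coef_in (fun x => (\adj (F x)) i j).
Proof.
move=> H m; under eq_fun do rewrite mxE.
have [Hc HM] := coef_in_subring.
apply: (HM (fun=> _) (fun x => \det (row' j (col' i (F x))))); first exact: Hc.
by apply: coef_in_det => k k' m'; under eq_fun do rewrite !mxE; exact: H.
Qed.

Lemma coef_in_pcm n (S : pred 'I_n) (b : T -> 'M[K]_n) i j :
  (forall i j, A (fun x => b x i j)) -> coef_in (fun x => pcm S (b x) i j).
Proof.
have [Ac _ _] := HA; move=> H m; under eq_fun do rewrite mxE.
case: (S i && S j); last exact: Ac.
under eq_fun do rewrite coefB coefC; apply: subring_sub; first exact: Ac.
by case: (m == 0%N); [exact: H|exact: Ac].
Qed.

Lemma coef_in_twists (I : eqType) (c : K) (y : I -> K) s p :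
  coef_in p -> coef_in (fun x => twists c y s (p x)).
Proof.
move=> H; elim: s => //= k s IH m; under eq_fun do rewrite coef_twist.
apply: subring_sub; apply: subring_scale; first exact: IH.
apply: subring_scale; exact: IH.
Qed.

Lemma horner_in N (p : T -> {poly K}) f : (forall x, size (p x) <= N)%N ->
  coef_in p -> A f -> A (fun x => (p x).[f x]).
Proof.
have [_ _ Am] := HA; move=> sp Hp Hf.
under eq_fun do rewrite (horner_coef_wide _ (sp _)).
by apply: subring_sum => i _; apply: Am => //; exact: subring_pow.
Qed.

End FunctionSubring.

(** * Integrals determined by laws *)

Lemma mfun_ex (d : measure_display) (T : measurableType d) (R : realType) (f : T -> R) :
  measurable_fun setT f -> exists F : {mfun T >-> R}, F = f :> (T -> R).
Proof. by move=> mf; exists (mfun_Sub (mem_set mf)). Qed.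

Lemma mfun_law_Rintegral (d : measure_display) (T : measurableType d) (R : realType)
    (mu : probability T R) (f g : {mfun T >-> R}) :
  mu.-integrable setT (EFin \o f) -> mu.-integrable setT (EFin \o g) ->
  (forall A : set R, measurable A -> mu (f @^-1` A) = mu (g @^-1` A)) ->
  \int[mu]_b f b = \int[mu]_b g b.
Proof.
move=> if_ ig H; congr fine.
have push (h : {mfun T >-> R}) : mu.-integrable setT (EFin \o h) ->
    (\int[mu]_b (h b)%:E = \int[pushforward mu h]_y y%:E)%E.
  by move=> ih; rewrite integral_pushforward.
rewrite !push //; apply: eq_measure_integral => A mA _.
exact: H.
Qed.

(* Comparing the laws of [f] and of [f \o coadjoint U] uses the invariance of the
   measure only through preimages, so [coadjoint U] need not be shown measurable. *)
Lemma law_Rintegral (d : measure_display) (T : measurableType d) (R : realType)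
    (mu : probability T R) (O : set T) (f g : T -> R) :
  measurable O -> mu O = 1%E ->
  measurable_fun setT f -> measurable_fun setT g ->
  mu.-integrable O (EFin \o f) -> mu.-integrable O (EFin \o g) ->
  (forall A : set R, measurable A -> mu (f @^-1` A) = mu (g @^-1` A)) ->
  \int[mu]_(b in O) f b = \int[mu]_(b in O) g b.
Proof.
move=> mO muO mf mg if_ ig H; rewrite (Rintegral_mkcond _ O f) (Rintegral_mkcond _ O g).
have muC : mu (~` O) = 0%E by rewrite probability_setC // muO subee.
have muI X : measurable X -> mu X = mu (X `&` O).
  move=> mX; rewrite (measureDI mu mX mO).
  rewrite (@subset_measure0 _ _ _ mu (X `\` O) (~` O)) ?add0e //.
  - exact: measurableD.
  - exact: measurableC.
have mres (h : T -> R) : measurable_fun setT h -> measurable_fun setT (h \_ O).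
  move=> mh; apply/(measurable_restrictT _ mO); exact: measurable_funTS.
have law (h : T -> R) (A : set R) : measurable_fun setT h -> measurable A ->
    mu ((h \_ O) @^-1` A) = mu (h @^-1` A).
  move=> mh mA; rewrite muI; last by rewrite -(setTI (_ @^-1` _)); exact: mres.
  rewrite [RHS]muI; last by rewrite -(setTI (_ @^-1` _)); exact: mh.
  congr (mu _); apply/seteqP; split => x [/= hx Ox]; split => //; move: hx;
    by rewrite patchT // inE.
have ires (h : T -> R) : mu.-integrable O (EFin \o h) ->
    mu.-integrable setT (EFin \o (h \_ O)).
  move=> ih; rewrite -restrict_EFin; exact/(integrable_mkcond _ mO).
have [F EF] := mfun_ex (mres f mf); have [G EG] := mfun_ex (mres g mg).
rewrite -EF -EG; apply: mfun_law_Rintegral; rewrite ?EF ?EG; try exact: ires.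
by move=> A mA; rewrite !law // H.
Qed.

Section OrbitIntegral.
Variables (R : realType) (n : nat).
Local Notation C := R[i].
Local Notation M := 'M[C]_n.
Implicit Types (f g : M -> C).

Definition cmeas f :=
  measurable_fun [set: borelMxC R n] (fun b => complex.Re (f b)) /\
  measurable_fun [set: borelMxC R n] (fun b => complex.Im (f b)).

Lemma cmeas_subring : fun_subring cmeas.
Proof.
split=> [c|f g [f1 f2] [g1 g2]|f g [f1 f2] [g1 g2]].
- by split; exact: measurable_cst.
- split; [under eq_fun do rewrite Re_add|under eq_fun do rewrite Im_add];
    exact: measurable_funD.
- split; [under eq_fun do rewrite Re_mul|under eq_fun do rewrite Im_mul].
    by apply: measurable_funB; exact: measurable_funM.
  by apply: measurable_funD; exact: measurable_funM.
Qed.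

Lemma lip_measurable (phi : C -> R) i j :
  (forall z w, `|phi z - phi w| <= normc (z - w)) ->
  measurable_fun [set: borelMxC R n] (fun b : M => phi (b i j)).
Proof.
move=> H; apply: (measurability _ (RGenOInfty.measurableE R)) => //.
move=> _ [_ [x ->] <-]; rewrite setTI; apply: sub_sigma_algebra.
rewrite openE => /= b; rewrite /= in_itv /= andbT => xb.
have e0 : (0 : (R[i] : numFieldType)) < (phi (b i j) - x)%:C by rewrite ltcR subr_gt0.
have := @coord_continuous (R[i] : numFieldType) n n i j b.
move=> /cvgrPdist_lt /(_ _ e0).
apply: filterS => c /=; rewrite in_itv /= andbT.
rewrite (_ : `|b i j - c i j| = (normc (b i j - c i j))%:C); last first.
  by case: (b i j - c i j).
rewrite ltcR => bc; have := le_lt_trans (H _ _) bc.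
rewrite ltr_norml => /andP[_]; lra.
Qed.

Lemma cmeas_entry i j : cmeas (fun b => b i j).
Proof.
split; apply: lip_measurable => z w.
- by rewrite -Re_opp -Re_add norm_Re_le.
- by rewrite -Im_opp -Im_add norm_Im_le.
Qed.

Lemma cmeas_char_poly m : cmeas (fun b => (char_poly b)`_m).
Proof.
under eq_fun do rewrite /char_poly -(@pcmT _ _ predT) //.
apply: (coef_in_det cmeas_subring) => i j; apply: (coef_in_pcm cmeas_subring) => k k'.
exact: cmeas_entry.
Qed.

Variable l : 'rV[R]_n.
Hypothesis n0 : (0 < n)%N.
Local Notation O := (orbit_SU l).

(** By [orbitP] the orbit is the zero set of [h], the sum of the squares of its equations: Hermitian
    symmetry and the coefficients of the characteristic polynomial up to degree [n]. *)
Lemma measurable_orbit : measurable (O : set (borelMxC R n)).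
Proof.
pose h (b : borelMxC R n) : R := \sum_(i < n) \sum_(j < n)
    (complex.Re (b i j - b j i) ^+ 2 + complex.Im (b i j + b j i) ^+ 2) +
  \sum_(m < n.+1) (complex.Re ((char_poly b)`_m - (orbit_poly l)`_m) ^+ 2 +
                   complex.Im ((char_poly b)`_m - (orbit_poly l)`_m) ^+ 2).
have mh : measurable_fun setT h.
  have [Ac Ad Am] := cmeas_subring.
  apply: measurable_funD; apply: measurable_sum => i.
    apply: measurable_sum => j; apply: measurable_funD; apply: measurable_funX.
      exact: (subring_sub cmeas_subring (cmeas_entry i j) (cmeas_entry j i)).1.
    exact: (Ad _ _ (cmeas_entry i j) (cmeas_entry j i)).2.
  by apply: measurable_funD; apply: measurable_funX;
    have [] := subring_sub cmeas_subring (cmeas_char_poly i) (Ac (orbit_poly l)`_i).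
have -> : (O : set (borelMxC R n)) = setT `&` h @^-1` [set 0].
  rewrite setTI; apply/seteqP; split => b.
    move=> /(orbitP _ _ n0)[hb cb]; rewrite /h /= cb.
    rewrite big1 => [|i _]; last first.
      rewrite big1 // => j _; have /matrixP/(_ j i) := hb; rewrite !mxE.
      case: (b i j) => x y /= <-; rewrite /= subrr addrN expr0n addr0 //.
    rewrite add0r big1 // => m _; rewrite subrr /= expr0n addr0 //.
  rewrite /h /= => /eqP; rewrite paddr_eq0; last 2 first.
  - by apply: sumr_ge0 => i _; apply: sumr_ge0 => j _; rewrite addr_ge0 ?sqr_ge0.
  - by apply: sumr_ge0 => i _; rewrite addr_ge0 ?sqr_ge0.
  move=> /andP[/eqP H1 /eqP H2]; apply/(orbitP _ _ n0); split.
    apply/matrixP => i j; rewrite !mxE.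
    have /psumr_eq0P H3 := H1.
    have /psumr_eq0P H4 := H3 (fun k _ => sumr_ge0 _ (fun k' _ =>
      addr_ge0 (sqr_ge0 _) (sqr_ge0 _))) i isT.
    have /eqP := H4 (fun k _ => addr_ge0 (sqr_ge0 _) (sqr_ge0 _)) j isT.
    rewrite paddr_eq0 ?sqr_ge0 // !sqrf_eq0 => /andP[].
    case: (b i j) => x y; case: (b j i) => z w /= /eqP H /eqP H'.
    by apply: complex_ext => /=; lra.
  apply/polyP => m; have [mn|mn] := ltnP m n.+1; last first.
    rewrite !nth_default // ?size_char_poly //.
    by rewrite -char_poly_cartan size_char_poly.
  have /eqP := psumr_eq0P (fun k _ => addr_ge0 (sqr_ge0 _) (sqr_ge0 _)) H2 (i := Ordinal mn) isT.
  rewrite paddr_eq0 ?sqr_ge0 // !sqrf_eq0 => /andP[/eqP a1 /eqP a2].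
  by apply/subr0_eq/complex_ext.
exact: mh.
Qed.

(** Measurability is asked everywhere but boundedness only on the orbit, since matrix entries are
    unbounded elsewhere; together they give integrability over the orbit. *)
Definition nice f := cmeas f /\ bnd O f.

Lemma nice_subring : fun_subring nice.
Proof.
have [Ac Ad Am] := cmeas_subring.
split=> [c|f g [f1 f2] [g1 g2]|f g [f1 f2] [g1 g2]].
- by split; [exact: Ac|exact: bnd_cst].
- by split; [exact: Ad|exact: bndD].
- by split; [exact: Am|exact: bndM].
Qed.

Lemma nice_entry i j : nice (fun b => b i j).
Proof. by split; [exact: cmeas_entry|exact: orbit_bnd]. Qed.

Lemma nice_expi (s : M -> C) : cmeas s -> nice (fun b => expi (complex.Re (s b))).
Proof.
move=> [s1 s2]; split; last by exists 1 => b _; rewrite normc_expi.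
split=> /=.
  exact: (measurableT_comp (continuous_measurable_fun (@continuous_cos R)) s1).
exact: (measurableT_comp (continuous_measurable_fun (@continuous_sin R)) s1).
Qed.

Variable mu : probability (borelMxC R n) R.
Hypothesis Hmu : is_orbit_measure l mu.

Definition orbit_mean f := Cintegral mu O f.
Local Notation E := orbit_mean.

Lemma nice_integrable f : nice f ->
  mu.-integrable O (EFin \o (fun b => complex.Re (f b))) /\
  mu.-integrable O (EFin \o (fun b => complex.Im (f b))).
Proof.
move=> [[f1 f2] [K HK]]; have muO : (mu O < +oo)%E by rewrite Hmu.1 ltry.
split; apply: measurable_bounded_integrable => //; try exact: measurable_orbit;
  try exact: measurable_funTS;
  exists K; split; rewrite ?num_real // => x Kx b Ob /=;
  apply: (le_trans _ (ltW Kx)); apply: (le_trans _ (HK _ Ob)).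
- exact: norm_Re_le.
- exact: norm_Im_le.
Qed.

Lemma mean_ext f g : (forall b, O b -> f b = g b) -> E f = E g.
Proof.
move=> H; rewrite /orbit_mean /Cintegral; congr (_ +i* _); apply: eq_Rintegral => b;
  by rewrite inE => /H ->.
Qed.

Lemma mean_add f g : nice f -> nice g -> E (fun b => f b + g b) = E f + E g.
Proof.
move=> /nice_integrable[f1 f2] /nice_integrable[g1 g2]; have mO := measurable_orbit.
by apply: complex_ext; rewrite /orbit_mean /Cintegral /= -RintegralD //;
  apply: eq_Rintegral => b _; rewrite ?Re_add ?Im_add.
Qed.

Lemma mean_scale c f : nice f -> E (fun b => c * f b) = c * E f.
Proof.
move=> nf; have /nice_integrable[f1 f2] := nf; have mO := measurable_orbit.
have [Ac Ad Am] := nice_subring.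
have int a : (EFin \o (fun b => a * complex.Re (f b)) : borelMxC R n -> _) =
  (EFin \o (fun b => complex.Re (a%:C * f b))).
  by apply/funext => b /=; rewrite Re_mul /= mul0r subr0.
have int' a : (EFin \o (fun b => a * complex.Im (f b)) : borelMxC R n -> _) =
  (EFin \o (fun b => complex.Im (a%:C * f b))).
  by apply/funext => b /=; rewrite Im_mul /= mul0r addr0.
have i1 a : mu.-integrable O (EFin \o (fun b => a * complex.Re (f b))).
  by rewrite int; exact: (nice_integrable (subring_scale nice_subring _ nf)).1.
have i2 a : mu.-integrable O (EFin \o (fun b => a * complex.Im (f b))).
  by rewrite int'; exact: (nice_integrable (subring_scale nice_subring _ nf)).2.
apply: complex_ext; rewrite ?Re_mul ?Im_mul /orbit_mean /Cintegral /= -!RintegralZl //.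
  by rewrite -RintegralB //; apply: eq_Rintegral => b _; rewrite Re_mul.
by rewrite -RintegralD //; apply: eq_Rintegral => b _; rewrite Im_mul.
Qed.

Lemma mean_sub f g : nice f -> nice g -> E (fun b => f b - g b) = E f - E g.
Proof.
move=> nf ng; under eq_fun do rewrite -mulN1r.
by rewrite mean_add ?mean_scale ?mulN1r //; exact: (subring_scale nice_subring (-1) ng).
Qed.

Lemma mean0 : E (fun=> 0) = 0.
Proof.
have [Ac Ad Am] := nice_subring.
under eq_fun do rewrite -(mul0r (0 : C)); by rewrite mean_scale ?mul0r.
Qed.

Lemma mean_sum I (r : seq I) (P : pred I) (f : I -> M -> C) :
  (forall i, P i -> nice (f i)) ->
  E (fun b => \sum_(i <- r | P i) f i b) = \sum_(i <- r | P i) E (f i).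
Proof.
move=> H; elim: r => [|i r IH].
  by under eq_fun do rewrite big_nil; rewrite mean0 big_nil.
under eq_fun do rewrite big_cons; rewrite big_cons.
have [Pi|_] := boolP (P i); last by [].
by rewrite mean_add ?IH //; [exact: H|exact: subring_sum nice_subring _ _ _ _ _].
Qed.

(** The factor [2] comes from bounding the real and imaginary parts separately. *)
Lemma mean_norm f K : nice f -> (forall b, O b -> normc (f b) <= K) ->
  normc (E f) <= 2 * K.
Proof.
move=> nf HK; have /nice_integrable[f1 f2] := nf; have mO := measurable_orbit.
have iK : mu.-integrable O (EFin \o (cst K)).
  have [Ac _ _] := nice_subring.
  exact: (nice_integrable (Ac K%:C)).1.
have bound h : mu.-integrable O (EFin \o h) -> (forall b, O b -> `|h b| <= K) ->
    `|\int[mu]_(b in O) h b| <= K.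
  move=> ih hK; apply: (le_trans (le_normr_Rintegral mO ih)).
  apply: (@le_trans _ _ (\int[mu]_(b in O) cst K b)).
    by apply: le_Rintegral => //; exact: integrable_norm.
  by rewrite Rintegral_cst // (congr1 fine Hmu.1) mulr1.
apply: (le_trans (normc_le _)); rewrite mulr_natl mulr2n lerD // bound // => b Ob.
  by rewrite (le_trans (norm_Re_le _)) ?HK.
by rewrite (le_trans (norm_Im_le _)) ?HK.
Qed.

Lemma mean_inv U f : SU R n U -> nice f -> nice (fun b => f (coadjoint U b)) ->
  E (fun b => f (coadjoint U b)) = E f.
Proof.
move=> SUU nf ng.
have [f1 f2] := nice_integrable nf; have [g1 g2] := nice_integrable ng.
case: nf ng => [[mf1 mf2] _] [[mg1 mg2] _].
rewrite /orbit_mean /Cintegral; congr (_ +i* _); apply: (law_Rintegral measurable_orbit Hmu.1) => // A mA.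
  rewrite -[RHS](Hmu.2 _ SUU) //; first by rewrite -(setTI (_ @^-1` _)); exact: mf1.
rewrite -[RHS](Hmu.2 _ SUU) //; by rewrite -(setTI (_ @^-1` _)); exact: mf2.
Qed.

End OrbitIntegral.

(** * Ward identities *)

Lemma oppmxE (V : zmodType) m n (A : 'M[V]_(m, n)) i j : (- A) i j = - A i j.
Proof. by rewrite mxE. Qed.

Lemma addmxE (V : nmodType) m n (A B : 'M[V]_(m, n)) i j : (A + B) i j = A i j + B i j.
Proof. by rewrite mxE. Qed.

Lemma scalemxE (K : pzSemiRingType) m n c (A : 'M[K]_(m, n)) i j : (c *: A) i j = c * A i j.
Proof. by rewrite mxE. Qed.

Lemma mulmxE (K : pzSemiRingType) m n p (A : 'M[K]_(m, n)) (B : 'M[K]_(n, p)) i j :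
  (A *m B) i j = \sum_k A i k * B k j.
Proof. by rewrite mxE. Qed.

Section MatrixSubring.
Variables (K : fieldType) (T : Type) (A : (T -> K) -> Prop) (n : nat).
Hypothesis HA : fun_subring A.
Implicit Types F G : T -> 'M[K]_n.

Lemma subring_mulmx F G : (forall i j, A (fun x => F x i j)) ->
  (forall i j, A (fun x => G x i j)) -> forall i j, A (fun x => (F x *m G x) i j).
Proof.
have [_ _ Am] := HA; move=> HF HG i j; under eq_fun do rewrite mulmxE.
by apply: (subring_sum HA) => k _; exact: Am.
Qed.

Lemma subring_addmx F G : (forall i j, A (fun x => F x i j)) ->
  (forall i j, A (fun x => G x i j)) -> forall i j, A (fun x => (F x + G x) i j).
Proof.
have [_ Ad _] := HA; move=> HF HG i j; under eq_fun do rewrite addmxE.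
exact: Ad.
Qed.

End MatrixSubring.

Lemma bnd_subring (R : realType) (T : Type) (D : T -> Prop) : fun_subring (@bnd R T D).
Proof. by split; [exact: bnd_cst|exact: bndD|exact: bndM]. Qed.

Lemma pow_deriv_step (K : comPzRingType) (f g : K) m :
  g * f ^+ m + f * (f ^+ m.-1 *+ m * g) = f ^+ m.+1.-1 *+ m.+1 * g.
Proof.
case: m => [|m] /=; first by rewrite mulr0n mul0r mulr0 addr0 mulr1n mulrC.
by rewrite mulrA mulrnAr -exprS mulrC -mulrDl -mulrS.
Qed.

Lemma linear_le_quadratic (R : realType) (e K : R) : 0 <= e ->
  (forall t, 0 < t <= 1 -> t * e <= 2 * (K * t ^+ 2)) -> e = 0.
Proof.
move=> e0 H; apply/eqP; rewrite eq_le e0 andbT leNgt; apply/negP => {}e0.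
pose K1 := `|K| + 1; have K10 : 0 < K1 by rewrite ltr_wpDl.
(* Small enough that [2 * (K * t) <= e / 2]; [K1] replaces [K] to have a positive denominator. *)
pose t := Num.min 1 (e / (4 * K1)).
have t0 : 0 < t by rewrite lt_min ltr01 divr_gt0 // mulr_gt0.
have tle : t <= e / (4 * K1) by rewrite ge_min lexx orbT.
have := H t; rewrite t0 ge_min lexx => /(_ isT).
have -> : 2 * (K * t ^+ 2) = t * (2 * (K * t)) by ring.
rewrite ler_pM2l //.
have : t * (4 * K1) <= e by rewrite -ler_pdivlMr // mulr_gt0.
have : K * t <= K1 * t by rewrite ler_pM2r // (le_trans (ler_norm K)) // lerDl.
move: (t) (K1) => x y; lra.
Qed.

(** * Rotations in a coordinate plane *)

Section PlaneRotationAlgebra.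
Variables (K : comNzRingType) (n : nat) (i0 k : 'I_n) (w v : K).
Hypotheses (ki : k != i0) (wv : w * v = 1).
Implicit Types c s : K.

Definition plane_proj : 'M[K]_n := delta_mx i0 i0 + delta_mx k k.
Definition plane_gen : 'M[K]_n := w *: delta_mx k i0 - v *: delta_mx i0 k.
(** Since [plane_gen] squares to [- plane_proj], this is the exponential of [t *: plane_gen] when
    [c] and [s] are the cosine and sine of [t]. *)
Definition plane_rot c s : 'M[K]_n := 1%:M + (c - 1) *: plane_proj + s *: plane_gen.

Let ik : i0 != k. Proof. by rewrite eq_sym. Qed.

Lemma proj_proj : plane_proj *m plane_proj = plane_proj.
Proof.
rewrite /plane_proj mulmxDl !mulmxDr !mul_delta_mx_cond !eqxx.
by rewrite (negbTE ki) (negbTE ik) !mulr1n !mulr0n addr0 add0r.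
Qed.

Lemma proj_gen : plane_proj *m plane_gen = plane_gen.
Proof.
rewrite /plane_proj /plane_gen mulmxDl !mulmxBr -!scalemxAr !mul_delta_mx_cond !eqxx.
by rewrite (negbTE ki) (negbTE ik) !mulr1n !mulr0n !scaler0 sub0r subr0 addrC.
Qed.

Lemma gen_proj : plane_gen *m plane_proj = plane_gen.
Proof.
rewrite /plane_proj /plane_gen mulmxBl !mulmxDr -!scalemxAl !mul_delta_mx_cond !eqxx.
by rewrite (negbTE ki) (negbTE ik) !mulr1n !mulr0n !scaler0 addr0 add0r.
Qed.

Lemma gen_gen : plane_gen *m plane_gen = - plane_proj.
Proof.
rewrite /plane_proj /plane_gen mulmxBl !mulmxBr -!scalemxAl -!scalemxAr !mul_delta_mx_cond !eqxx.
rewrite (negbTE ki) (negbTE ik) !mulr1n !mulr0n !scaler0 !scalerA (mulrC v) wv !scale1r.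
by rewrite sub0r subr0 opprD addrC.
Qed.

Lemma plane_gen_commutator (X : 'M[K]_n) p q :
  (plane_gen *m X) p q - (X *m plane_gen) p q =
  w * (X i0 q *+ (p == k) - X p k *+ (q == i0)) -
  v * (X k q *+ (p == i0) - X p i0 *+ (q == k)).
Proof.
have dl i j : (delta_mx i j *m X) p q = X j q *+ (p == i).
  rewrite mxE (bigD1 j) //= big1 => [|r rj]; rewrite mxE ?eqxx ?(negbTE rj).
    by rewrite andbT addr0 mulr_natl.
  by rewrite andbF mul0r.
have dr i j : (X *m delta_mx i j) p q = X p i *+ (q == j).
  rewrite mxE (bigD1 i) //= big1 => [|r ri]; rewrite mxE ?eqxx ?(negbTE ri).
    by rewrite addr0 mulr_natr.
  by rewrite mulr0.
rewrite /plane_gen mulmxBl mulmxBr -!scalemxAl -!scalemxAr !addmxE !oppmxE !scalemxE.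
by rewrite !dl !dr; ring.
Qed.

Lemma plane_rotM c s c' s' :
  plane_rot c s *m plane_rot c' s' = plane_rot (c * c' - s * s') (s * c' + c * s').
Proof.
rewrite /plane_rot !mulmxDl !mulmxDr !mul1mx !mulmx1 -!scalemxAl -!scalemxAr.
rewrite proj_proj proj_gen gen_proj gen_gen.
move: plane_proj plane_gen => P A; apply/matrixP => p q; rewrite !mxE.
by move: (P p q) (A p q) (_ *+ _) => x y z; ring.
Qed.

Lemma plane_rot1 : plane_rot 1 0 = 1%:M.
Proof. by rewrite /plane_rot subrr !scale0r !addr0. Qed.

(** Conjugation by the reflection [D], which changes the sign of coordinate [k], fixes [plane_proj]
    and negates [plane_gen]. *)
Lemma det_plane_rotN c s : \det (plane_rot c (- s)) = \det (plane_rot c s).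
Proof.
pose D : 'M[K]_n := diag_mx (\row_j (if j == k then -1 else 1)).
have DXD X p q : (D *m X *m D) p q =
    (if p == k then -1 else 1) * X p q * (if q == k then -1 else 1).
  by rewrite mul_mx_diag mul_diag_mx !mxE.
have DD : D *m D = 1%:M.
  rewrite -[D in D *m _]mulmx1; apply/matrixP => p q; rewrite DXD !mxE.
  have [->|pq] := eqVneq p q; last by rewrite mulr0 mul0r.
  by case: (q == k); ring.
have DP : D *m plane_proj *m D = plane_proj.
  apply/matrixP => p q; rewrite DXD !mxE; case: (eqVneq p k) => [->|pk].
    by rewrite (negbTE ki) /=; case: (q == k); rewrite ?mulr0n ?mulr1n; ring.
  case: (eqVneq q k) => [->|qk]; last by ring.
  by rewrite (negbTE ki) andbF /= mulr0n; ring.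
have DA : D *m plane_gen *m D = - plane_gen.
  apply/matrixP => p q; rewrite DXD !mxE; case: (eqVneq p k) => [->|pk].
    by rewrite (negbTE ki) /=; case: (eqVneq q k) => [->|qk]; rewrite ?(negbTE ki) /= ?mulr0n; ring.
  by case: (eqVneq q k) => [->|qk] /=; rewrite ?andbF ?mulr0n; ring.
have <- : D *m plane_rot c s *m D = plane_rot c (- s).
  rewrite /plane_rot !mulmxDr !mulmxDl mulmx1 DD -!scalemxAr -!scalemxAl.
  by rewrite DP DA scalerN scaleNr.
by rewrite !det_mulmx mulrAC -det_mulmx DD det1 mul1r.
Qed.

Lemma plane_rot_adjoint (f : {rmorphism K -> K}) c s : f w = v -> f v = w ->
  map_mx f (plane_rot c s)^T = plane_rot (f c) (- f s).
Proof.
move=> fw fv; apply/matrixP => p q; rewrite !mxE.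
rewrite !(rmorphD, rmorphN, rmorphM, rmorph_nat, rmorphB, rmorph1) /= fw fv.
by rewrite (eq_sym q p) !(andbC (q == _)); ring.
Qed.

End PlaneRotationAlgebra.

Section PlaneRotation.
Variables (R : realType) (n : nat) (i0 k : 'I_n) (w : R[i]).
Hypotheses (ki : k != i0) (w1 : w * w^* = 1).
Local Notation M := 'M[R[i]]_n.

Definition rot (t : R) : M := plane_rot i0 k w w^* (cos t)%:C (sin t)%:C.

Lemma rotD s t : rot (s + t) = rot s *m rot t.
Proof.
rewrite /rot (plane_rotM ki w1) !real_complexM real_complexB real_complexD -cosD.
by rewrite -sinD.
Qed.

Lemma rot0 : rot 0 = 1%:M.
Proof. by rewrite /rot cos0 sin0 plane_rot1. Qed.

Lemma rotNr t : rot (- t) *m rot t = 1%:M.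
Proof. by rewrite -rotD addNr rot0. Qed.

Lemma rotrN t : rot t *m rot (- t) = 1%:M.
Proof. by rewrite -rotD subrr rot0. Qed.

Lemma rot_opp t : rot (- t) = plane_rot i0 k w w^* (cos t)%:C (- (sin t)%:C).
Proof. by rewrite /rot cosN sinN real_complexN. Qed.

Lemma rot_adjoint t : (rot t)^t* = rot (- t).
Proof.
have cR x : (x%:C : R[i])^* = x%:C := conjc_real x.
rewrite rot_opp.
apply: etrans (@plane_rot_adjoint R[i] n i0 k w w^* Num.conj (cos t)%:C (sin t)%:C erefl (conjCK w)) _.
rewrite -{2}(cR (cos t)) -{2}(cR (sin t)).
reflexivity.
Qed.

Lemma rot_unitary t : rot t \is unitarymx.
Proof. by apply/unitarymxP; rewrite rot_adjoint rotrN. Qed.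

(** Opposite angles have equal determinants with product [1], so every determinant squares to [1];
    halving the angle exhibits [\det (rot t)] as such a square. *)
Lemma det_rot t : \det (rot t) = 1.
Proof.
have sq s : \det (rot s) ^+ 2 = 1.
  have E : \det (rot (- s)) = \det (rot s).
    by rewrite rot_opp; exact: (det_plane_rotN w w^* ki (cos s)%:C (sin s)%:C).
  by rewrite expr2 -{1}E -det_mulmx rotNr det1.
by rewrite (_ : t = t / 2 + t / 2) ?rotD ?det_mulmx -?expr2 ?sq //; field.
Qed.

Lemma rot_SU t : SU R n (rot t).
Proof. by split; [exact: rot_unitary|exact: det_rot]. Qed.

Lemma coadjoint_rot t b : coadjoint (rot t) b = rot t *m b *m rot (- t).
Proof. by rewrite /coadjoint (invmx_unitary (rot_unitary t)) rot_adjoint. Qed.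

End PlaneRotation.

Section Ward.
Variables (R : realType) (n : nat) (l : 'rV[R]_n) (mu : probability (borelMxC R n) R).
Hypotheses (n0 : (0 < n)%N) (Hmu : is_orbit_measure l mu).
Variables (i0 k : 'I_n).
Hypothesis (ki : k != i0).
Local Notation C := R[i].
Local Notation M := 'M[C]_n.
Local Notation O := (orbit_SU l).
Local Notation E := (orbit_mean l mu).
Local Notation nice := (nice l).
Implicit Types f g : M -> C.

(** Pairing the point of the orbit with the angle makes every expansion over [dom] uniform along the
    orbit. *)
Let dom (p : M * R) := O p.1 /\ `|p.2| <= 1.
Let par (p : M * R) := p.2.
Let par1 p : dom p -> `|par p| <= 1. Proof. by case. Qed.

Lemma approx_mulmx (F' F F1 G' G G1 : M * R -> M) :
  (forall p q, bnd dom (fun x => F x p q)) -> (forall p q, bnd dom (fun x => F1 x p q)) ->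
  (forall p q, bnd dom (fun x => G x p q)) -> (forall p q, bnd dom (fun x => G1 x p q)) ->
  (forall p q, approx dom par (fun x => F' x p q) (fun x => F x p q) (fun x => F1 x p q)) ->
  (forall p q, approx dom par (fun x => G' x p q) (fun x => G x p q) (fun x => G1 x p q)) ->
  forall p q, approx dom par (fun x => (F' x *m G' x) p q) (fun x => (F x *m G x) p q)
    (fun x => (F1 x *m G x + F x *m G1 x) p q).
Proof.
move=> bF bF1 bG bG1 aF aG p q.
pose H j := approxM par1 (bF p j) (bF1 p j) (bG j q) (bG1 j q) (aF p j) (aG j q).
have S := approx_sum (P := xpredT) (index_enum 'I_n) (fun j _ => H j).
apply: (approx_ext _ S) => x _.
by split; rewrite ?addmxE !mulmxE // -big_split.
Qed.

Lemma bnd_dom f : bnd O f -> bnd dom (fun p => f p.1).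
Proof. by move=> [K HK]; exists K => p [/HK]. Qed.

Lemma approx_cos : approx dom par (fun p => (cos p.2 - 1)%:C) (fun=> 0) (fun=> 0).
Proof.
exists 1 => p [_ p1]; rewrite mulr0 !subr0 normcR mul1r (le_trans (norm_cosB1_le _)) //.
by rewrite ler_pdivrMr // ler_peMr ?sqr_ge0 // ler1n.
Qed.

Lemma approx_sin : approx dom par (fun p => (sin p.2)%:C) (fun=> 0) (fun=> 1).
Proof.
by exists 1 => p [_ p1]; rewrite subr0 mulr1 real_complexB normcR mul1r norm_sinB_le.
Qed.

Lemma approx_rot w p q : approx dom par (fun x => rot i0 k w x.2 p q)
  (fun=> (1%:M : M) p q) (fun=> plane_gen i0 k w w^* p q).
Proof.
apply: approx_ext (approxD (approxD (approx_cst dom par (fun=> (1%:M : M) p q))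
  (approxZ (@plane_proj C n i0 k p q) approx_cos))
  (approxZ (plane_gen i0 k w w^* p q) approx_sin)) => x _; split.
- rewrite /rot /plane_rot; move: (plane_proj _ _ _) (plane_gen _ _ _ _) => P A.
  rewrite mxE [X in X + _ = _]mxE [X in _ + X = _]mxE [X in _ + X + _ = _]mxE.
  by rewrite (mulrC (P p q)) (mulrC (A p q)) -?real_complexB.
- by rewrite !mulr0 !addr0.
- by rewrite mulr0 mulr1 !add0r.
Qed.

Lemma approx_conj w (Phi : M -> M) p q : (forall i j, bnd O (fun b => Phi b i j)) ->
  approx dom par (fun x => (rot i0 k w x.2 *m Phi x.1 *m rot i0 k w (- x.2)) p q)
   (fun x => Phi x.1 p q)
   (fun x => (plane_gen i0 k w w^* *m Phi x.1 - Phi x.1 *m plane_gen i0 k w w^*) p q).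
Proof.
move=> bP; set A := plane_gen _ _ _ _.
have rotN r s : approx dom par (fun x => rot i0 k w (- x.2) r s)
    (fun=> (1%:M : M) r s) (fun=> (- A) r s).
  have [K HK] := approx_rot w r s; exists K => -[b t] [/= Ob t1].
  have := HK (b, - t); rewrite /dom /par /= normrN sqrrN => /(_ (conj Ob t1)).
  by rewrite -real_complexN mulNr oppmxE mulrN.
have H1 := @approx_mulmx (fun x => rot i0 k w x.2) (fun=> 1%:M) (fun=> A)
  (fun x => Phi x.1) (fun x => Phi x.1) (fun=> 0)
  (fun _ _ => bnd_cst _ _) (fun _ _ => bnd_cst _ _) (fun i j => bnd_dom (bP i j))
  (fun _ _ => bnd_cst _ _) (approx_rot w).
have aPhi i j : approx dom par (fun x => Phi x.1 i j) (fun x => Phi x.1 i j) (fun=> (0 : M) i j).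
  by apply: (approx_ext _ (approx_cst dom par (fun x => Phi x.1 i j))) => x _; rewrite mxE.
have {}H1 := H1 aPhi.
have Sb := bnd_subring R dom; have bc (X : M) i j : bnd dom (fun=> X i j) by exact: bnd_cst.
have bPhi i j : bnd dom (fun x => Phi x.1 i j) := bnd_dom (bP i j).
have bAP i j : bnd dom (fun x => (A *m Phi x.1 + 1%:M *m 0) i j).
  by apply: (subring_addmx Sb) => r s; apply: (subring_mulmx Sb).
have b1P i j : bnd dom (fun x => (1%:M *m Phi x.1) i j).
  by apply: (subring_mulmx Sb).
have H2 := @approx_mulmx _ _ _ (fun x => rot i0 k w (- x.2)) (fun=> 1%:M) (fun=> - A)
  b1P bAP (bc _) (bc _) H1 rotN p q.
apply: (approx_ext _ H2) => x _.
by rewrite !mul1mx !mulmx1 addr0 mulmxN.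
Qed.

Definition conj_rot w t (b : M) : M := rot i0 k w t *m b *m rot i0 k w (- t).

(* [g] and [g'] are the derivatives of [f] along [[E, b]] for [E = E_{k,i0}] and
   [E = E_{i0,k}]; only [w E_{k,i0} - w^* E_{i0,k}] with [|w| = 1] is tangent to [SU]. *)
Definition LD f g g' := [/\ nice f, nice g, nice g' & forall w, w * w^* = 1 ->
  (forall t, nice (fun b => f (conj_rot w t b))) /\
  approx dom par (fun x => f (conj_rot w x.2 x.1)) (fun x => f x.1)
    (fun x => w * g x.1 - w^* * g' x.1)].

Let Ns := nice_subring l.
Let bnice f : nice f -> bnd dom (fun x => f x.1). Proof. by move=> [_ /bnd_dom]. Qed.

Lemma LD_cst c : LD (fun=> c) (fun=> 0) (fun=> 0).
Proof.
have [Nc _ _] := Ns; split=> // w _; split=> //.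
by apply: (approx_ext _ (approx_cst dom par (fun=> c))) => x _; rewrite !mulr0 subr0.
Qed.

Lemma LD_ext f g g' h h' : LD f g g' -> g =1 h -> g' =1 h' -> LD f h h'.
Proof. by move=> H /funext <- /funext <-. Qed.

Lemma LD_add f g g' f2 g2 g2' : LD f g g' -> LD f2 g2 g2' ->
  LD (fun b => f b + f2 b) (fun b => g b + g2 b) (fun b => g' b + g2' b).
Proof.
have [_ Nd _] := Ns; move=> [nf ng ng' H] [nf2 ng2 ng2' H2]; split; try exact: Nd.
move=> w w1; have [H3 H4] := H w w1; have [H5 H6] := H2 w w1.
split=> [t|]; first exact: Nd.
by apply: (approx_ext _ (approxD H4 H6)) => x _; split=> //; ring.
Qed.

Lemma LD_mul f g g' f2 g2 g2' : LD f g g' -> LD f2 g2 g2' ->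
  LD (fun b => f b * f2 b) (fun b => g b * f2 b + f b * g2 b)
    (fun b => g' b * f2 b + f b * g2' b).
Proof.
have [Nc Nd Nm] := Ns; move=> [nf ng ng' H] [nf2 ng2 ng2' H2].
split; try by [exact: Nm|apply: Nd; exact: Nm].
move=> w w1; have [H3 H4] := H w w1; have [H5 H6] := H2 w w1.
split=> [t|]; first exact: Nm.
have b1 h h' : nice h -> nice h' -> bnd dom (fun x => w * h x.1 - w^* * h' x.1).
  by move=> nh nh'; apply: (bnice (subring_sub Ns (subring_scale Ns _ nh) (subring_scale Ns _ nh'))).
have := approxM par1 (bnice nf) (b1 _ _ ng ng') (bnice nf2) (b1 _ _ ng2 ng2') H4 H6.
by apply: approx_ext => x _; split=> //; ring.
Qed.

Lemma LD_scale c f g g' : LD f g g' ->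
  LD (fun b => c * f b) (fun b => c * g b) (fun b => c * g' b).
Proof.
by move=> H; apply: LD_ext (LD_mul (LD_cst c) H) _ _ => b; rewrite mul0r add0r.
Qed.

Lemma LD_sum (I : Type) (r : seq I) (f g g' : I -> M -> C) :
  (forall i, LD (f i) (g i) (g' i)) ->
  LD (fun b => \sum_(i <- r) f i b) (fun b => \sum_(i <- r) g i b)
    (fun b => \sum_(i <- r) g' i b).
Proof.
move=> H; elim: r => [|i r IH].
  by under eq_fun do rewrite big_nil; apply: LD_ext (LD_cst 0) _ _ => b; rewrite big_nil.
under eq_fun do rewrite big_cons.
by apply: LD_ext (LD_add (H i) IH) _ _ => b; rewrite big_cons.
Qed.

Lemma LD_pow f g g' m : LD f g g' ->
  LD (fun b => f b ^+ m) (fun b => (f b ^+ m.-1 *+ m) * g b) (fun b => (f b ^+ m.-1 *+ m) * g' b).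
Proof.
move=> H; elim: m => [|m IH].
  by apply: LD_ext (LD_cst 1) _ _ => b; rewrite mulr0n mul0r.
under eq_fun do rewrite exprS.
by apply: LD_ext (LD_mul H IH) _ _ => b; exact: pow_deriv_step.
Qed.

(** Equivariance turns a rotation of the argument into a conjugation of the value, so the
    derivatives are entries of the commutators of [E_{k,i0}] and [E_{i0,k}] with [Phi b]. This
    serves for [b] itself and for the coefficients of adjugates. *)
Lemma LD_equiv (Phi : M -> M) p q : (forall i j, nice (fun b => Phi b i j)) ->
  (forall w t b, w * w^* = 1 -> Phi (conj_rot w t b) = conj_rot w t (Phi b)) ->
  LD (fun b => Phi b p q)
    (fun b => Phi b i0 q *+ (p == k) - Phi b p k *+ (q == i0))
    (fun b => Phi b k q *+ (p == i0) - Phi b p i0 *+ (q == k)).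
Proof.
have [Nc Nd Nm] := Ns; move=> nP HP.
have nPn i j (c : bool) : nice (fun b => Phi b i j *+ c).
  by case: c; [exact: nP|exact: Nc].
split; [exact: nP|exact: (subring_sub Ns (nPn _ _ _) (nPn _ _ _))|
  exact: (subring_sub Ns (nPn _ _ _) (nPn _ _ _))|].
move=> w w1; split=> [t|].
  under eq_fun do rewrite HP //.
  by apply: (subring_mulmx Ns) => // i j; apply: (subring_mulmx Ns).
have := approx_conj w p q (fun i j => (nP i j).2).
apply: approx_ext => x _; split=> //; first by rewrite HP.
by rewrite addmxE oppmxE plane_gen_commutator.
Qed.

Lemma mean_linear f g c : nice f -> nice g -> E (fun b => f b + c * g b) = E f + c * E g.
Proof.
move=> nf ng; rewrite (mean_add n0 Hmu) ?(mean_scale n0 Hmu) //.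
exact: (subring_scale Ns _ ng).
Qed.

(** By invariance the terms of order zero cancel in the mean of the expansion, which leaves [|t|]
    times the norm of the mean derivative bounded by a multiple of [t^2]. *)
Lemma ward_rot f g g' w : LD f g g' -> w * w^* = 1 ->
  E (fun b => w * g b - w^* * g' b) = 0.
Proof.
move=> [nf ng ng' H] w1; have [nfw [K HK]] := H w w1.
set D := fun b => _; have nD : nice D.
  exact: (subring_sub Ns (subring_scale Ns _ ng) (subring_scale Ns _ ng')).
have bound t : `|t| <= 1 -> `|t| * normc (E D) <= 2 * (K * t ^+ 2).
  move=> t1.
  have nr : nice (fun b => f (conj_rot w t b) - f b - t%:C * D b).
    exact: (subring_sub Ns (subring_sub Ns (nfw t) nf) (subring_scale Ns _ nD)).
  have := mean_norm n0 Hmu (K := K * t ^+ 2) nr (fun b Ob => HK (b, t) (conj Ob t1)).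
  rewrite (mean_sub n0 Hmu (subring_sub Ns (nfw t) nf) (subring_scale Ns _ nD)).
  rewrite (mean_sub n0 Hmu (nfw t) nf) (mean_scale n0 Hmu _ nD).
  have -> : E (fun b => f (conj_rot w t b)) = E f.
    have := mean_inv n0 Hmu (rot_SU ki w1 t) nf.
    under eq_fun do rewrite (coadjoint_rot ki w1).
    by apply; exact: nfw.
  by rewrite subrr sub0r normcN normcM normcR.
apply/eq0_normc/(linear_le_quadratic (K := K) (normc_ge0 _)) => t /andP[t0 t1].
by have := bound t; rewrite gtr0_norm // => /(_ t1).
Qed.

(* The choices [w = 1] and [w = 'i] separate the contributions of [g] and [g']. *)
Lemma ward f g g' : LD f g g' -> E g = 0.
Proof.
move=> H; have [nf ng ng' _] := H.
have Ed c d : E (fun b => c * g b - d * g' b) = c * E g - d * E g'.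
  rewrite (mean_sub n0 Hmu (subring_scale Ns _ ng) (subring_scale Ns _ ng')).
  by rewrite !(mean_scale n0 Hmu).
have w1 : (1 : C) * 1^* = 1 by rewrite rmorph1 mulr1.
have wi : ('i : C) * 'i^* = 1.
  by apply: complex_ext => /=; ring.
have := ward_rot H w1; have := ward_rot H wi; rewrite !Ed rmorph1 !mul1r.
have -> : ('i : C)^* = - 'i by apply: complex_ext => /=; rewrite ?oppr0.
rewrite mulNr opprK -mulrDr => /eqP; rewrite mulf_eq0 => /orP[/eqP /(congr1 (@complex.Im R)) /= /eqP|/eqP H1 H2].
  by rewrite oner_eq0.
have : E g + E g + (E g' - E g') = 0 by rewrite addrACA H1 H2 addr0.
rewrite subrr addr0 -mulr2n => /eqP; rewrite mulrn_eq0 /= => /eqP //.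
Qed.

Definition phase (u : 'I_n -> R) (b : M) : C := \sum_j (u j)%:C * b j j.
(** On the orbit [phase] is real. Taking its real part keeps the weight of modulus one on all
    matrices. *)
Definition weight u b : C := expi (complex.Re (phase u b)).

Lemma LD_phase u : LD (phase u) (fun b => - ((u i0 - u k)%:C * b i0 k))
  (fun b => (u i0 - u k)%:C * b k i0).
Proof.
have Hd j := LD_scale (u j)%:C (@LD_equiv id j j (nice_entry l) (fun _ _ _ _ => erefl)).
apply: LD_ext (LD_sum (index_enum 'I_n) Hd) _ _ => b.
- rewrite (bigD1 k) //= (bigD1 i0) ?(eq_sym i0 k) //= big1 => [|j /andP[jk ji]].
    rewrite !eqxx (negbTE ki) !mulr1n !mulr0n -real_complexB; ring.
  by rewrite (negbTE jk) (negbTE ji) !mulr0n subr0 mulr0.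
- rewrite (bigD1 k) //= (bigD1 i0) ?(eq_sym i0 k) //= big1 => [|j /andP[jk ji]].
    rewrite !eqxx (negbTE ki) !mulr1n !mulr0n -real_complexB; ring.
  by rewrite (negbTE jk) (negbTE ji) !mulr0n subr0 mulr0.
Qed.

Lemma nice_weight u : nice (weight u).
Proof.
apply: nice_expi; apply: (subring_sum (cmeas_subring R n)) => j _.
by apply: (subring_scale (cmeas_subring R n)); exact: cmeas_entry.
Qed.

Lemma orbit_conj b i j : O b -> (b i j)^* = b j i.
Proof. by move=> /(orbitP _ _ n0)[/matrixP/(_ j i)]; rewrite !mxE. Qed.

Lemma LD_weight u : LD (weight u)
  (fun b => - ('i * (u i0 - u k)%:C * b i0 k * weight u b))
  (fun b => 'i * (u i0 - u k)%:C * b k i0 * weight u b).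
Proof.
have [_ _ Nm] := Ns; have nw := nice_weight u.
have [np ng ng' H] := LD_phase u.
have nz i j : nice (fun b => 'i * (u i0 - u k)%:C * b i j * weight u b).
  apply: Nm => //; apply: (subring_scale Ns); exact: nice_entry.
split=> //; first by under eq_fun do rewrite -mulN1r; exact: (subring_scale Ns).
move=> w w1; have [Hn Ha] := H w w1.
split=> [t|]; first by apply: nice_expi; have [] := Hn t.
have bD : bnd dom (fun x => (complex.Re (w * - ((u i0 - u k)%:C * x.1 i0 k) -
    w^* * ((u i0 - u k)%:C * x.1 k i0)))%:C).
  have [_ [K HK]] := subring_sub Ns (subring_scale Ns w ng) (subring_scale Ns w^* ng').
  exists K => y [Oy _]; apply: le_trans (HK _ Oy).
  by rewrite normcR norm_Re_le.
have := approx_expi par1 bD (approx_Re Ha).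
apply: approx_ext => y [Oy _]; split=> //.
rewrite [(complex.Re _)%:C](_ : _ = w * - ((u i0 - u k)%:C * y.1 i0 k) -
    w^* * ((u i0 - u k)%:C * y.1 k i0)); last first.
  rewrite -(orbit_conj i0 k Oy); move: (y.1 i0 k) (u i0 - u k) => z a.
  clear; case: w z => p q [r s]; apply: complex_ext => //=; ring.
by rewrite -/(weight u y.1); ring.
Qed.

End Ward.

(** * Ward identities for minors of the characteristic matrix *)

Section PolynomialSizes.
Variable K : fieldType.

Lemma size_det_le n (F : 'M[{poly K}]_n) : (forall i j, size (F i j) <= 2)%N ->
  (size (\det F) <= n.+1)%N.
Proof.
move=> HF; apply: (leq_trans (size_sum _ _ _)); apply/bigmax_leqP => s _.
rewrite size_Msign; apply: (leq_trans (size_prod_leq _ _)).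
rewrite cardT size_enum_ord leq_subLR.
apply: (@leq_trans (\sum_(i < n) 2).+1); first by rewrite ltnS leq_sum.
by rewrite sum_nat_const card_ord muln2 -addnn addnS.
Qed.

Lemma size_pcm n S (b : 'M[K]_n) i j : (size (pcm S b i j) <= 2)%N.
Proof.
rewrite mxE; case: ifP => _; last first.
  by case: (i == j); rewrite ?size_poly0 // size_poly1.
apply: (leq_trans (size_polyD _ _)); rewrite geq_max size_polyN (leq_trans (size_polyC_leq1 _)) // andbT.
by case: (i == j); rewrite ?mulr0n ?size_poly0 // mulr1n size_polyX.
Qed.

Lemma size_adj_pcm n S (b : 'M[K]_n) i j : (size (\adj (pcm S b) i j) <= n.+1)%N.
Proof.
rewrite mxE /cofactor size_Msign; apply: (leq_trans (size_det_le _)).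
  move=> k k'; rewrite [row' _ _ _ _]mxE [col' _ _ _ _]mxE; exact: size_pcm.
by rewrite ltnS leq_pred.
Qed.

Lemma horner_deriv_wide N (p : {poly K}) a : (size p <= N)%N ->
  p^`().[a] = \sum_(i < N) p`_i * (a ^+ i.-1 *+ i).
Proof.
move=> sp; have -> : p = \sum_(i < N) p`_i *: 'X^i.
  rewrite -{1}[p]coefK; apply/polyP => m; rewrite coef_poly.
  rewrite coef_sum; case: ltnP => ms.
    rewrite (bigD1 (Ordinal (leq_trans ms sp))) //= coefZ coefXn eqxx mulr1 big1 ?addr0 //.
    by move=> j; rewrite -val_eqE /= coefZ coefXn eq_sym => /negbTE ->; rewrite mulr0.
  rewrite big1 // => j _; rewrite coefZ coefXn.
  by case: eqVneq => [<-|_]; rewrite ?mulr0 // nth_default ?mul0r.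
rewrite raddf_sum /= horner_sum; apply: eq_bigr => i _.
rewrite derivZ derivXn hornerZ hornerMn hornerXn.
rewrite coef_sum (bigD1 i) //= coefZ coefXn eqxx mulr1 big1 ?addr0 //.
by move=> j; rewrite -val_eqE /= coefZ coefXn eq_sym => /negbTE ->; rewrite mulr0.
Qed.

End PolynomialSizes.

Section WardPoly.
Variables (R : realType) (n : nat) (l : 'rV[R]_n) (i0 k : 'I_n).
Hypothesis (ki : k != i0).
Local Notation C := R[i].
Local Notation M := 'M[C]_n.
Local Notation LD := (LD l i0 k).
Local Notation nice := (nice l).

Definition LDp (p g g' : M -> {poly C}) :=
  forall m, LD (fun b => (p b)`_m) (fun b => (g b)`_m) (fun b => (g' b)`_m).

Lemma LD_sub f g g' f2 g2 g2' : LD f g g' -> LD f2 g2 g2' ->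
  LD (fun b => f b - f2 b) (fun b => g b - g2 b) (fun b => g' b - g2' b).
Proof.
move=> H H2; under eq_fun do rewrite -mulN1r.
by apply: LD_ext (LD_add H (LD_scale (-1) H2)) _ _ => b; rewrite mulN1r.
Qed.

Lemma LDp_twists (I : eqType) c (y : I -> C) s p g g' : LDp p g g' ->
  LDp (fun b => twists c y s (p b)) (fun b => twists c y s (g b)) (fun b => twists c y s (g' b)).
Proof.
move=> H; elim: s => // j s IH m /=; under eq_fun do rewrite coef_twist.
by apply: LD_ext (LD_sub (LD_scale (y j) (IH m))
  (LD_scale c (LD_scale m.+1%:R (IH m.+1)))) _ _ => b; rewrite coef_twist.
Qed.

Lemma LD_horner N (p g g' : M -> {poly C}) (a ga ga' : M -> C) : (forall b, size (p b) <= N)%N ->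
  (forall b, size (g b) <= N)%N -> (forall b, size (g' b) <= N)%N ->
  LDp p g g' -> LD a ga ga' ->
  LD (fun b => (p b).[a b]) (fun b => (g b).[a b] + (p b)^`().[a b] * ga b)
    (fun b => (g' b).[a b] + (p b)^`().[a b] * ga' b).
Proof.
move=> sp sg sg' Hp Ha; under eq_fun do rewrite (horner_coef_wide _ (sp _)).
apply: LD_ext (LD_sum (index_enum 'I_N) (fun i => LD_mul (Hp i) (LD_pow i Ha))) _ _ => b.
- rewrite big_split /= (horner_coef_wide _ (sg b)) (horner_deriv_wide _ (sp b)) mulr_suml.
  by congr (_ + _); apply: eq_bigr => i _; rewrite mulrA.
- rewrite big_split /= (horner_coef_wide _ (sg' b)) (horner_deriv_wide _ (sp b)) mulr_suml.
  by congr (_ + _); apply: eq_bigr => i _; rewrite mulrA.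
Qed.

Lemma plane_rot_id (w v c s : C) i j : ~~ (((i == i0) || (i == k)) && ((j == i0) || (j == k))) ->
  plane_rot i0 k w v c s i j = (i == j)%:R.
Proof.
move=> H; rewrite /plane_rot !addmxE !scalemxE /plane_proj /plane_gen !addmxE oppmxE !scalemxE ![delta_mx _ _ _ _]mxE.
have E a b : ((a == i0) || (a == k)) -> ((b == i0) || (b == k)) -> (i == a) && (j == b) = false.
  move=> Ha Hb; apply: contraNF H => /andP[/eqP -> /eqP ->]; by rewrite Ha Hb.
by rewrite !E ?eqxx ?orbT // mxE !(mulr0n, mulr0, subr0, addr0, oppr0).
Qed.

Variable S : pred 'I_n.
Hypotheses (S0 : S i0) (Sk : S k).

Lemma nice_adj p q m : nice (fun b => (\adj (pcm S b) p q)`_m).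
Proof.
have Ns := nice_subring l.
apply: (coef_in_adj Ns) => i j; apply: (coef_in_pcm Ns) => i' j'; exact: nice_entry.
Qed.

(** As [S] contains [i0] and [k], the rotation is the identity outside the block of [S] and
    conjugates the adjugate. Its entries being scalars, this holds coefficient by coefficient. *)
Lemma adj_coef_conj m w t (b : M) : w * w^* = 1 ->
  (\matrix_(p, q) (\adj (pcm S (conj_rot i0 k w t b)) p q)`_m : M) =
  conj_rot i0 k w t (\matrix_(p, q) (\adj (pcm S b) p q)`_m).
Proof.
move=> w1; rewrite /conj_rot adj_pcm_conj ?(rotNr ki w1) //; last first.
  move=> i j Sij; rewrite /rot plane_rot_id //; apply: contraNN Sij.
  by move=> /andP[/orP[/eqP->|/eqP->] /orP[/eqP->|/eqP->]]; rewrite ?S0 ?Sk.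
move: (rot _ _ _ _) (rot _ _ _ (- t)) => P Q; apply/matrixP => p q.
rewrite mxE !mulmxE coef_sum; apply: eq_bigr => j _.
rewrite [map_mx polyC Q j q]mxE coefMC; congr (_ * _).
rewrite !mulmxE coef_sum; apply: eq_bigr => i _.
by rewrite [map_mx polyC P p i]mxE coefCM; congr (_ * _); rewrite [RHS]mxE.
Qed.

(** The entry [(k, i0)] is chosen because its commutator with [E_{k,i0}] involves only diagonal
    adjugate entries, that is, principal minors, and that with [E_{i0,k}] vanishes. *)
Lemma LDp_adj : LDp (fun b => \adj (pcm S b) k i0)
  (fun b => \adj (pcm S b) i0 i0 - \adj (pcm S b) k k) (fun=> 0).
Proof.
move=> m; pose Phi b : M := \matrix_(p, q) (\adj (pcm S b) p q)`_m.
have nP i j : nice (fun b => Phi b i j).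
  by under eq_fun do rewrite mxE; exact: nice_adj.
have H := @LD_equiv R n l i0 k Phi k i0 nP (fun w t b w1 => adj_coef_conj m t b w1).
have -> : (fun b => (\adj (pcm S b) k i0)`_m) = (fun b => Phi b k i0).
  by apply/funext => b; rewrite /Phi [RHS]mxE.
apply: LD_ext H _ _.
- by move=> b; rewrite /= !eqxx !mulr1n /Phi coefB; congr (_ - _); rewrite [LHS]mxE.
- by move=> b; rewrite /= (negbTE ki) eq_sym (negbTE ki) !mulr0n subr0 coef0.
Qed.

End WardPoly.

Lemma mul_ii (R : realType) : 'i * 'i = -1 :> R[i].
Proof. by rewrite -expr2 sqr_i. Qed.

(** Here [c] is ['i], [a3] is [b i0 k], and [a7], [a4] are the values of [p] and its derivative: the
    variations of the weight and of the evaluation point merge into the twist [a1 * a7 - c * a4]. *)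
Lemma twist_identity (K : comPzRingType) (c a1 a2 a3 a4 a5 a6 a7 : K) : c * c = -1 ->
  - (c * a1 * a3 * a2) * a7 + a2 * (a6 - a5 + a4 * - a3) =
  a2 * a6 - a2 * a5 + - c * (a2 * (a3 * (a1 * a7 - c * a4))).
Proof.
move=> cc; have -> : - c * (a2 * (a3 * (a1 * a7 - c * a4))) =
  - c * a2 * a3 * a1 * a7 + c * c * (a2 * a3 * a4) by ring.
by rewrite cc; ring.
Qed.

Section Recursion.
Variables (R : realType) (n : nat) (l : 'rV[R]_n) (mu : probability (borelMxC R n) R).
Hypotheses (n0 : (0 < n)%N) (Hmu : is_orbit_measure l mu).
Variables (i0 : 'I_n) (u : 'I_n -> R).
Local Notation C := R[i].
Local Notation M := 'M[C]_n.
Local Notation E := (orbit_mean l mu).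
Local Notation nice := (nice l).
Local Notation W := (weight u).
Let y j := (u i0 - u j)%:C : C.
Local Notation D := (twists 'i y).

Let Ns := nice_subring l.

Lemma nice_twisted S s i j :
  nice (fun b => W b * (D s (\adj (pcm S b) i j)).[b i0 i0]).
Proof.
have [_ _ Nm] := Ns; apply: Nm; first exact: nice_weight.
apply: (horner_in Ns (N := n.+1)); last exact: nice_entry.
  by move=> b; apply: (leq_trans (size_twists _ _ _ _)); exact: size_adj_pcm.
by apply: (coef_in_twists Ns) => m; exact: nice_adj.
Qed.

Lemma nice_twisted_entry k S s i j :
  nice (fun b => W b * (b i0 k * (D s (\adj (pcm S b) i j)).[b i0 i0])).
Proof.
have [_ _ Nm] := Ns; under eq_fun do rewrite mulrCA.
by apply: Nm; [exact: nice_entry|exact: nice_twisted].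
Qed.

(** The Ward identity is applied with the twist [k] left out; the derivatives of the weight and of
    the evaluation point supply it, which restores [D s] on the left. *)
Lemma ward_minor s k : uniq (i0 :: s) -> k \in s -> let S := mem (i0 :: s) in
  E (fun b => W b * (b i0 k * (D s (\adj (pcm S b) k i0)).[b i0 i0])) =
  - 'i * (E (fun b => W b * (D (rem k s) (\adj (pcm S b) i0 i0)).[b i0 i0]) -
          E (fun b => W b * (D (rem k s) (\adj (pcm S b) k k)).[b i0 i0])).
Proof.
move=> us ks S; have ki : k != i0 by apply: contraTneq ks => ->; case/andP: us.
have S0 : S i0 by rewrite /S /= inE eqxx.
have Sk : S k by rewrite /S /= inE ks orbT.
set T := rem k s; pose p b := D T (\adj (pcm S b) k i0).
pose G b := D T (\adj (pcm S b) i0 i0 - \adj (pcm S b) k k).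
have Lp : LDp l i0 k p G (fun=> D T 0) by apply: LDp_twists; exact: LDp_adj.
have La := @LD_equiv R n l i0 k id i0 i0 (nice_entry l) (fun _ _ _ _ => erefl).
have sp b : (size (p b) <= n.+1)%N.
  by apply: (leq_trans (size_twists _ _ _ _)); exact: size_adj_pcm.
have sG b : (size (G b) <= n.+1)%N.
  apply: (leq_trans (size_twists _ _ _ _)); apply: (leq_trans (size_polyD _ _)).
  by rewrite size_polyN geq_max !size_adj_pcm.
have s0 (b : M) : (size (D T 0) <= n.+1)%N by rewrite twists0 size_poly0.
have H := LD_mul (LD_weight l n0 ki u) (LD_horner sp sG s0 Lp La).
have := ward n0 Hmu ki H.
set X := fun b => W b * (b i0 k * _).
rewrite [E (fun b => _ + _)](_ : _ =
  E (fun b => (W b * (D T (\adj (pcm S b) i0 i0)).[b i0 i0] - W b * (D T (\adj (pcm S b) k k)).[b i0 i0])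
     + (- 'i) * X b)); last first.
  apply: mean_ext => b _; rewrite /X (twists_rem _ _ _ ks) -/T /twist -/(p b) /G twistsD twistsN.
  rewrite eqxx eq_sym (negbTE ki) !mulr0n mulr1n !(hornerD, hornerN, hornerZ) sub0r /y.
  move: (_ %:C) (W b) (b i0 k) (_.[_]) (_.[_]) (_.[_]) (_.[_]) => a1 a2 a3 a4 a5 a6 a7.
  exact: (@twist_identity C 'i a1 a2 a3 a4 a5 a6 a7 (mul_ii R)).
have nX : nice X by exact: nice_twisted_entry.
rewrite (mean_linear n0 Hmu _ (subring_sub Ns (nice_twisted _ _ _ _) (nice_twisted _ _ _ _)) nX).
rewrite (mean_sub n0 Hmu (nice_twisted _ _ _ _) (nice_twisted _ _ _ _)).
move: (E X) (E _ - E _) => x z /eqP; rewrite mulNr subr_eq0 => /eqP ->.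
by rewrite mulrA mulNr mul_ii opprK mul1r.
Qed.

(** In the Laplace expansion each [k] contributes [- 'i * A k - X k]. As the mean of [X k] is [- 'i]
    times that of [A k - B k], only [- 'i * B k] remains, and [B k] is the same expression with [k]
    removed from [s]. *)
Lemma twisted_char_poly s : uniq (i0 :: s) ->
  E (fun b => W b * (D s (\det (pcm (mem (i0 :: s)) b))).[b i0 i0]) = 0.
Proof.
elim: {s}(size s) {-2}s (erefl (size s)) => [|m IH] s sm us.
  (* For a single index the determinant is ['X - b i0 i0], which vanishes at the evaluation
     point. *)
  apply: etrans (mean_ext (g := fun=> 0) _ _) (mean0 n0 Hmu) => b _.
  rewrite (det_pcm_expand _ us) (size0nil sm) big_nil subr0 /=.
  by rewrite hornerM hornerXsubC subrr mul0r mulr0.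
pose S := mem (i0 :: s).
pose A k b := W b * (D (rem k s) (\adj (pcm S b) i0 i0)).[b i0 i0].
pose X k b := W b * (b i0 k * (D s (\adj (pcm S b) k i0)).[b i0 i0]).
pose B k b := W b * (D (rem k s) (\adj (pcm S b) k k)).[b i0 i0].
have -> : E (fun b => W b * (D s (\det (pcm S b))).[b i0 i0]) =
    E (fun b => \sum_(k <- s) (- 'i * A k b - X k b)).
  apply: mean_ext => b _; rewrite det_pcm_expand // -/S twistsD twistsN twists_XsubC; last by case/andP: us.
  rewrite !(hornerD, hornerN, hornerM, hornerX, hornerC, hornerZ) subrr mul0r sub0r.
  rewrite twists_sum !horner_sum big_split /= sumrN -mulr_sumr.
  rewrite mulrBr mulrN; congr (_ - _).
    by rewrite mulNr mulrCA mulr_sumr.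
  by rewrite mulr_sumr; apply: eq_bigr => k _; rewrite mul_polyC twistsZ hornerZ.
have nX k : nice (X k) by exact: nice_twisted_entry.
have nA k : nice (A k) by exact: nice_twisted.
have nB k : nice (B k) by exact: nice_twisted.
rewrite (mean_sum n0 Hmu) => [|k _]; last first.
  exact: (subring_sub Ns (subring_scale Ns _ (nA k)) (nX k)).
rewrite big_seq big1 // => k ks.
rewrite (mean_sub n0 Hmu (subring_scale Ns _ (nA k)) (nX k)) (mean_scale n0 Hmu _ (nA k)).
have /= -> := ward_minor us ks; rewrite -/S -/(A k) -/(B k).
suff -> : E (B k) = 0 by ring.
have us' : uniq (i0 :: rem k s).
  case/andP: us => i0s us; rewrite /= rem_uniq // andbT.
  by apply: contra i0s => /mem_rem.
have sm' : size (rem k s) = m by rewrite size_rem // sm.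
rewrite -[RHS](IH _ sm' us'); apply: mean_ext => b _; rewrite /B adj_pcm_diag; last first.
  by rewrite /S /= inE ks orbT.
rewrite (@eq_pcm _ _ _ (mem (i0 :: rem k s))) // => j /=.
rewrite /S /= !inE mem_rem_uniq ?inE; last by case/andP: us.
have ki : k != i0 by apply: contraTneq ks => ->; case/andP: us.
by case: eqVneq => [->|jk] /=; rewrite ?(negbTE ki).
Qed.

End Recursion.

(** * Dependence on one coordinate *)

(** Lagrange interpolation of the constant [1]: the difference has [n] roots and degree below
    [n]. *)
Lemma lagrange_sum (K : fieldType) n (a : 'I_n -> K) : (0 < n)%N -> injective a ->
  \sum_j (\prod_(k | k != j) (a j - a k))^-1 *: \prod_(k | k != j) ('X - (a k)%:P) = 1.
Proof.
move=> n0 ia; apply/eqP; rewrite -subr_eq0; apply/eqP.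
apply: (@roots_geq_poly_eq0 _ _ [seq a j | j <- enum 'I_n]).
- apply/allP => _ /mapP[i _ ->]; rewrite /root hornerD hornerN hornerC horner_sum (bigD1 i) //=.
  rewrite [X in _ + X - _]big1 ?addr0 => [|j ji].
    rewrite hornerZ horner_prod; under [X in _ * X]eq_bigr do rewrite hornerXsubC.
    rewrite mulVf ?subrr //; apply/prodf_neq0 => k ki.
    by rewrite subr_eq0 (inj_eq ia) eq_sym.
  rewrite hornerZ horner_prod [X in _ * X](bigD1 i) 1?eq_sym //= hornerXsubC subrr.
  by rewrite mul0r mulr0.
- by rewrite map_inj_uniq // enum_uniq.
- rewrite size_map size_enum_ord; apply: (leq_trans (size_polyD _ _)).
  rewrite geq_max size_polyN size_poly1 n0 andbT.
  apply: (leq_trans (size_sum _ _ _)); apply/bigmax_leqP => j _.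
  apply: (leq_trans (size_scale_leq _ _)); rewrite -big_filter size_prod_XsubC.
  by rewrite -sum1_size big_filter sum1_card cardC1 card_ord ltn_predL.
Qed.

Section OneCoordinate.
Variables (R : realType) (n : nat) (l : 'rV[R]_n) (mu : probability (borelMxC R n) R).
Hypotheses (n0 : (0 < n)%N) (Hmu : is_orbit_measure l mu).
Variables (i0 : 'I_n) (u : 'I_n -> R).
Local Notation C := R[i].
Local Notation M := 'M[C]_n.
Local Notation E := (orbit_mean l mu).
Local Notation nice := (nice l).
Local Notation O := (orbit_SU l).

Definition upd t j := if j == i0 then t else u j.
Definition rate t j : C := (upd t i0 - upd t j)%:C.

Let Ns := nice_subring l.

Lemma weight_upd t h b : O b ->
  weight (upd (t + h)) b = weight (upd t) b * expi (h * complex.Re (b i0 i0)).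
Proof.
move=> Ob; rewrite /weight -expiD; congr expi.
have -> : phase (upd (t + h)) b = phase (upd t) b + h%:C * b i0 i0.
  rewrite /phase (bigD1 i0) //= [in RHS](bigD1 i0) //= /upd eqxx.
  under eq_bigr => j ji do rewrite (negbTE ji).
  under [in RHS]eq_bigr => j ji do rewrite (negbTE ji).
  by rewrite -real_complexD; ring.
by rewrite Re_add Re_mul /= mul0r subr0.
Qed.

Lemma cder_mean g : nice g -> cder (fun t => E (fun b => weight (upd t) b * g b))
  (fun t => 'i * E (fun b => weight (upd t) b * (b i0 i0 * g b))).
Proof.
move=> ng t; have [Nc Nd Nm] := Ns.
have nw v : nice (weight v) := nice_weight l v.
have nb : nice (fun b => b i0 i0) := nice_entry l i0 i0.
have [_ [Kb HKb]] := nb; have [_ [Kg HKg]] := ng.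
(* The outer [2] is that of [mean_norm], the inner one that of [expi_taylor]. *)
exists (2 * (2 * Kb ^+ 2 * Kg)) => h _.
have n1 v : nice (fun b => weight v b * g b) by exact: Nm.
have n2 v : nice (fun b => weight v b * (b i0 i0 * g b)) by apply: (Nm _ _) => //; exact: Nm.
rewrite (mulrA h%:C) -(mean_scale n0 Hmu _ (n2 _)).
rewrite -(mean_sub n0 Hmu (n1 _) (n1 _)).
rewrite -(mean_sub n0 Hmu (subring_sub Ns (n1 _) (n1 _)) (subring_scale Ns _ (n2 _))).
rewrite -[leRHS]mulrA; apply: (mean_norm n0 Hmu).
  exact: (subring_sub Ns (subring_sub Ns (n1 _) (n1 _)) (subring_scale Ns _ (n2 _))).
move=> b Ob; rewrite weight_upd //.
set r := complex.Re (b i0 i0).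
have br : b i0 i0 = r%:C := orbit_diag_real i0 n0 Ob.
rewrite [X in normc X](_ : _ = weight (upd t) b * (expi (h * r) - 1 - 'i * (h * r)%:C) * g b); last first.
  by rewrite br -real_complexM; ring.
rewrite !normcM normc_expi mul1r [leRHS]mulrAC ler_pM ?normc_ge0 ?HKg //.
apply: (le_trans (expi_taylor _)); rewrite exprMn -[leRHS]mulrA ler_pM2l // mulrC ler_wpM2r ?sqr_ge0 //.
have /HKb := Ob; rewrite br normcR => rK.
rewrite -(real_normK (num_real r)) lerXn2r ?nnegrE // (le_trans _ rK) //.
Qed.

Definition twisted s (p : {poly C}) t : C :=
  E (fun b => weight (upd t) b * (twists 'i (rate t) s p).[b i0 i0]).

Lemma nice_horner p : nice (fun b => p.[b i0 i0]).
Proof.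
have [Nc Nd Nm] := Ns; exact: (horner_in Ns (N := size p) (fun=> leqnn _) (fun m => Nc _) (nice_entry l i0 i0)).
Qed.

Let nice_integrand t p : nice (fun b => weight (upd t) b * p.[b i0 i0]).
Proof. by have [_ _ Nm] := Ns; apply: Nm; [exact: nice_weight|exact: nice_horner]. Qed.

Lemma twistedD s p q t : twisted s (p + q) t = twisted s p t + twisted s q t.
Proof.
rewrite /twisted twistsD -(mean_add n0 Hmu (nice_integrand _ _) (nice_integrand _ _)).
by apply: mean_ext => b _; rewrite hornerD mulrDr.
Qed.

Lemma twistedZ s c p t : twisted s (c *: p) t = c * twisted s p t.
Proof.
rewrite /twisted twistsZ -(mean_scale n0 Hmu _ (nice_integrand _ _)).
by apply: mean_ext => b _; rewrite hornerZ mulrCA.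
Qed.

Lemma twisted_cons j s p t : j != i0 ->
  twisted (j :: s) p t = (t - u j)%:C * twisted s p t - 'i * twisted s p^`() t.
Proof.
move=> ji; rewrite -!twistedZ /twisted -(mean_sub n0 Hmu (nice_integrand _ _) (nice_integrand _ _)).
apply: mean_ext => b _; rewrite -mulrBr !twistsZ twists_deriv /= /twist -hornerN -hornerD.
by rewrite /rate /upd eqxx (negbTE ji).
Qed.

(** The coefficient [t - u j] of each twist also depends on [t]. Its derivative contributes exactly
    the term [p] of [('X * p)^]() = p + 'X * p^[()], because [- 'i * 'i = 1]. *)
Lemma cder_twisted s p : i0 \notin s ->
  cder (twisted s p) (fun t => 'i * twisted s ('X * p) t).
Proof.
elim: s p => [|j s IH] p.
  move=> _; apply: cder_ext (cder_mean (nice_horner p)) => // t.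
  congr (_ * _); apply: mean_ext => b _ /=; by rewrite hornerM hornerX.
rewrite inE negb_or => /andP[ji js]; rewrite eq_sym in ji.
have D1 : cder (fun t => (t - u j)%:C) (fun=> 1).
  apply: cder_ext (cderD (@cder_id R) (cder_cst (- (u j))%:C)) => t /=.
    by rewrite real_complexD.
  by rewrite addr0.
apply: cder_ext (cderD (cderM D1 (IH p js)) (cderZ (- 'i) (IH p^`() js))) => t.
  by rewrite twisted_cons // mulNr.
rewrite twisted_cons // derivM derivX !mul1r twistedD.
have := mul_ii R; move: ('i : C) => c cc.
move: (twisted _ _ _) (twisted _ _ _) (twisted _ _ _) (_ %:C) => x1 x2 x3 x4.
transitivity (x3 + x4 * (c * x2) - c * c * x1); first by ring.
transitivity (x4 * (c * x2) - c * c * (x3 + x1)); last by ring.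
by rewrite cc; ring.
Qed.

Definition others : seq 'I_n := rem i0 (enum 'I_n).

Lemma mem_others j : (j \in others) = (j != i0).
Proof. by rewrite /others mem_rem_uniq ?enum_uniq // !inE mem_enum andbT. Qed.

Lemma uniq_others : uniq (i0 :: others).
Proof. by rewrite /= mem_others eqxx rem_uniq // enum_uniq. Qed.

Lemma size_others : size others = n.-1.
Proof. by rewrite size_rem ?mem_enum // size_enum_ord. Qed.

Lemma twisted_orbit_poly t : twisted others (orbit_poly l) t = 0.
Proof.
apply: etrans (mean_ext _ _) (twisted_char_poly n0 Hmu (upd t) uniq_others) => b Ob.
have [_ <-] := (orbitP l b n0).1 Ob.
rewrite /char_poly -(@pcmT _ _ (mem (i0 :: others))) // => j.
by rewrite /= inE mem_others; case: eqVneq.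
Qed.

Lemma twisted_one s t : i0 \notin s ->
  twisted s 1 t = (\prod_(j <- s) (t - u j)%:C) * E (weight (upd t)).
Proof.
elim: s => [|j s IH].
  move=> _; rewrite big_nil mul1r /twisted; apply: mean_ext => b _.
  by rewrite /= hornerC mulr1.
rewrite inE negb_or => /andP[ji js]; rewrite twisted_cons 1?eq_sym // IH // big_cons.
have -> : (1 : {poly C})^`() = 0 *: 0 by rewrite -polyC1 derivC scale0r.
by rewrite twistedZ mul0r mulr0 subr0 mulrA.
Qed.

Let cofactor_poly j : {poly C} := \prod_(k | k != j) ('X - ((l 0 k)%:C)%:P).

(** Modulo [orbit_poly l], whose twisted mean is zero, multiplication by ['X] acts on
    [cofactor_poly j] as the scalar [l 0 j]. *)
Lemma twisted_eigen j t : twisted others (cofactor_poly j) t =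
  twisted others (cofactor_poly j) 0 * expi (l 0 j * t).
Proof.
have i0s : i0 \notin others by rewrite mem_others eqxx.
apply: (cder_eigen (u := twisted others (cofactor_poly j))).
apply: cder_ext (cder_twisted (cofactor_poly j) i0s) => // {}t.
have -> : 'X * cofactor_poly j = orbit_poly l + (l 0 j)%:C *: cofactor_poly j.
  by rewrite /orbit_poly (bigD1 j) //= -/(cofactor_poly j) -mul_polyC; ring.
by rewrite twistedD twistedZ twisted_orbit_poly add0r mulrA.
Qed.

Lemma exponential_sum : injective (fun j => l 0 j) -> exists d : 'I_n -> C, forall t,
  (\prod_(j <- others) (t - u j)%:C) * E (weight (upd t)) = \sum_j d j * expi (l 0 j * t).
Proof.
move=> il; have i0s : i0 \notin others by rewrite mem_others eqxx.
have iC : injective (fun j => (l 0 j)%:C : C) by move=> j k [/il].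
exists (fun j => (\prod_(k | k != j) ((l 0 j)%:C - (l 0 k)%:C))^-1 *
   twisted others (cofactor_poly j) 0) => t.
rewrite -twisted_one // -(lagrange_sum n0 iC).
rewrite (big_morph (fun p => twisted others p t) (fun p q => twistedD _ p q t) (_ : _ = 0)).
  by apply: eq_bigr => j _; rewrite twistedZ -/(cofactor_poly j) twisted_eigen mulrA.
by rewrite -(scale0r 0) twistedZ mul0r.
Qed.

End OneCoordinate.

Lemma expi_sub (R : realType) (a b : R) :
  expi a - expi b = expi ((a + b) / 2) * (2 * 'i * (sin ((a - b) / 2))%:C).
Proof.
have -> : expi a = expi ((a + b) / 2) * expi ((a - b) / 2).
  by rewrite -expiD; congr expi; field.
have -> : expi b = expi ((a + b) / 2) * expi (- ((a - b) / 2)).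
  by rewrite -expiD; congr expi; field.
rewrite -mulrBr; congr (_ * _).
apply: complex_ext; rewrite /= ?cosN ?sinN; ring.
Qed.

Definition rho (R : realType) n : 'rV[R]_n := \row_j (n.-1%:R / 2 - j%:R).

Section Rho.
Variables (R : realType) (n : nat) (mu : probability (borelMxC R n) R).
Local Notation C := R[i].
Local Notation rho := (rho R n).
Hypotheses (n0 : (0 < n)%N) (Hmu : is_orbit_measure rho mu).
Variables (i0 : 'I_n) (u : 'I_n -> R).
Local Notation E := (orbit_mean rho mu).
Hypothesis generic : forall j k, j != i0 -> k != i0 -> j != k -> sin ((u j - u k) / 2) != 0.

Lemma rho_inj : injective (fun j => rho 0 j).
Proof.
move=> j k; rewrite !mxE => /addrI /oppr_inj /eqP; rewrite eqr_nat => /eqP jk.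
exact: val_inj.
Qed.

Lemma expi_neq (a b : R) : sin ((a - b) / 2) != 0 -> expi (- a) != expi (- b).
Proof.
move=> H; rewrite -subr_eq0 expi_sub mulf_neq0 ?expi_neq0 // !mulf_neq0 ?pnatr_eq0 //.
  by rewrite -normr_eq0 normCi oner_eq0.
rewrite eq_complex /= eqxx andbT opprK addrC (_ : (b - a) / 2 = - ((a - b) / 2)) ?sinN ?oppr_eq0 //.
by rewrite -mulNr opprB.
Qed.

(* The exponential sum is [expi ((n-1)t/2) q(expi (-t))] with [size q <= n], and [q]
   vanishes at the [n-1] points [expi (- u j)], which determines it up to a factor. *)
Lemma one_coordinate : exists K : C, forall t,
  (\prod_(j <- others i0) (t - u j)%:C) * E (weight (upd i0 u t)) =
  K * \prod_(j <- others i0) (sin ((t - u j) / 2))%:C.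
Proof.
have [d Hd] := exponential_sum n0 Hmu i0 u rho_inj.
pose q : {poly C} := \sum_(j < n) d j *: 'X^j.
have qE t : (\prod_(j <- others i0) (t - u j)%:C) * E (weight (upd i0 u t)) =
    expi (n.-1%:R / 2 * t) * q.[expi (- t)].
  rewrite Hd horner_sum mulr_sumr; apply: eq_bigr => j _.
  rewrite hornerZ hornerXn mulrCA -expi_mulrn -expiD; congr (_ * expi _).
  by rewrite mxE; ring.
have sq : (size q <= n)%N.
  apply: (leq_trans (size_sum _ _ _)); apply/bigmax_leqP => j _.
  by apply: (leq_trans (size_scale_leq _ _)); rewrite size_polyXn.
pose rs := [seq expi (- u j) | j <- others i0].
have rq : all (root q) rs.
  apply/allP => _ /mapP[j js ->]; rewrite /root.
  have := qE (u j); rewrite (big_rem j) //= subrr !mul0r => /esym/eqP.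
  by rewrite mulf_eq0 (negbTE (expi_neq0 _)).
have ur : uniq_roots rs.
  rewrite uniq_rootsE map_inj_in_uniq; first by have /andP[] := uniq_others i0.
  move=> j k; rewrite !mem_others => ji ki /eqP H; apply/eqP/negPn/negP => jk.
  by move: H; apply/negP/expi_neq/generic.
have [p Ep] := uniq_roots_prod_XsubC rq ur.
have [c Ec] : exists c, p = c%:P.
  have [p0|p0] := eqVneq p 0; first by exists 0; rewrite p0.
  exists p`_0; apply: size1_polyC.
  have := sq; rewrite Ep size_Mmonic ?monic_prod_XsubC // size_prod_XsubC size_map size_others.
  by rewrite prednK // -subn1 leq_subLR leq_add2r.
exists (c * \prod_(j <- others i0) (expi (- (u j) / 2) * (- (2 * 'i)))) => t.
rewrite qE Ep Ec hornerM hornerC horner_prod big_map.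
under eq_bigr => j _ do rewrite hornerXsubC expi_sub opprK [- t + u j]addrC.
have -> : \prod_(j <- others i0) (expi ((- t - u j) / 2) * (2 * 'i * (sin ((u j - t) / 2))%:C)) =
   expi (- t / 2) ^+ n.-1 * (\prod_(j <- others i0) (expi (- (u j) / 2) * (- (2 * 'i))) *
   \prod_(j <- others i0) (sin ((t - u j) / 2))%:C).
  rewrite -(size_others i0); elim: (others i0) => [|j s IH].
    by rewrite !big_nil expr0 !mulr1.
  rewrite /= !big_cons IH exprS.
  have -> : expi ((- t - u j) / 2) * (2 * 'i * (sin ((u j - t) / 2))%:C) =
      expi (- t / 2) * (expi (- u j / 2) * - (2 * 'i)) * (sin ((t - u j) / 2))%:C.
    rewrite (_ : (- t - u j) / 2 = - t / 2 + - u j / 2); last by field.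
    rewrite expiD (_ : (u j - t) / 2 = - ((t - u j) / 2)); last by field.
    by rewrite sinN -real_complexN; ring.
  ring.
(* The phase of the top exponent [(n-1)/2] cancels the [n-1] half-angle phases, leaving a product of
   sines. *)
have e1 : expi (n.-1%:R / 2 * t) * expi (- t / 2) ^+ n.-1 = 1 :> C.
  by rewrite -expi_mulrn -expiD (_ : _ + _ = 0) ?expi0 //; field.
by rewrite mulrCA [X in _ * X]mulrA e1 mul1r mulrA.
Qed.

Lemma prod_others (K : comNzRingType) (f : 'I_n -> K) :
  \prod_(j <- others i0) f j = \prod_(j | j != i0) f j.
Proof.
rewrite big_uniq /=; last by have /andP[] := uniq_others i0.
by apply: eq_bigl => j; rewrite mem_others.
Qed.

Lemma one_coordinate_sinc : exists K : C, forall t, (forall k, k != i0 -> t != u k) ->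
  E (weight (upd i0 u t)) = K * (\prod_(k | k != i0) sinc ((t - u k) / 2))%:C.
Proof.
(* One factor [1/2] per index, from [sin (z / 2) = sinc (z / 2) * (z / 2)]. *)
have [K HK] := one_coordinate; exists (K * (2^-1) ^+ n.-1) => t tu.
have P0 : \prod_(j <- others i0) (t - u j)%:C != 0 :> C.
  rewrite prod_others; apply/prodf_neq0 => k ki.
  by rewrite eq_complex /= eqxx andbT subr_eq0 tu.
apply: (mulfI P0); rewrite HK -prod_others rmorph_prod /=.
rewrite -(size_others i0) -mulrA mulrCA; congr (_ * _).
elim: (others i0) => [|j s IH]; first by rewrite !big_nil expr0 !mulr1.
rewrite /= !big_cons exprS IH.
have -> : sin ((t - u j) / 2) = sinc ((t - u j) / 2) * ((t - u j) / 2).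
  by rewrite /sinc; case: eqP => [->|/eqP H]; rewrite ?sin0 ?mulr0 ?divfK.
rewrite -!real_complexM.
have -> : (2^-1)%:C = 2^-1 :> C by rewrite fmorphV rmorph_nat.
ring.
Qed.

End Rho.

(** * The product formula for [rho] *)

Section ProductFormula.
Variables (R : realType) (n : nat) (mu : probability (borelMxC R n) R).
Local Notation C := R[i].
Local Notation rho := (rho R n).
Hypotheses (n0 : (0 < n)%N) (Hmu : is_orbit_measure rho mu).
Implicit Types (u v x y : 'I_n -> R).
Local Notation E := (orbit_mean rho mu).

Definition charE v := E (weight v).
(** Sines are asked to be nonzero, rather than coordinates distinct, so that the roots
    [expi (- v j)] are distinct and [sinc_prod v] can be divided by. *)
Definition generic v := forall j k, j != k -> sin ((v j - v k) / 2) != 0.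

Lemma generic_neq v j k : generic v -> j != k -> v j != v k.
Proof. by move=> Gv /Gv; apply: contraNneq => ->; rewrite subrr mul0r sin0. Qed.

(** The unknown factor is eliminated between two values of the same coordinate; the sincs of pairs
    avoiding [i0] are common to both sides. *)
Lemma charE_upd i0 v t : generic v -> generic (upd i0 v t) ->
  charE (upd i0 v t) * (sinc_prod v)%:C = charE v * (sinc_prod (upd i0 v t))%:C.
Proof.
move=> Gv Gt; have [K HK] := one_coordinate_sinc n0 Hmu (i0 := i0) (u := v) (fun j k _ _ => Gv j k).
have Ev : v = upd i0 v (v i0) by apply/funext => j; rewrite /upd; case: eqVneq => [->|].
rewrite /charE HK => [|k ki]; last first.
  by have := generic_neq Gt (_ : i0 != k); rewrite /upd eqxx (negbTE ki) eq_sym; apply.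
rewrite [in RHS]Ev HK => [|k ki]; last by rewrite (generic_neq Gv) // eq_sym.
rewrite -Ev -!mulrA; congr (_ * _); rewrite !real_complexM; congr (_%:C).
rewrite (sinc_prod_split v i0) (sinc_prod_split (upd i0 v t) i0).
rewrite mulrCA; congr (_ * _); congr (_ * _).
  by apply: eq_bigr => k ki; rewrite /upd eqxx (negbTE ki).
apply: eq_bigr => j ji; apply: eq_bigr => k /andP[ki _].
by rewrite /upd (negbTE ji) (negbTE ki).
Qed.

(** Coordinates pass from [x] to [y] one by one through the points [z m]; the hypothesis on mixed
    differences keeps these generic. *)
Lemma charE_cross x y : generic x -> generic y ->
  (forall j k, j != k -> sin ((y j - x k) / 2) != 0) ->
  charE y * (sinc_prod x)%:C = charE x * (sinc_prod y)%:C.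
Proof.
move=> Gx Gy Gxy; pose z m (j : 'I_n) := if (j < m)%N then y j else x j.
have Gz m : generic (z m).
  move=> j k jk; rewrite /z; case: ifP => _; case: ifP => _; first exact: Gy.
  - exact: Gxy.
  - rewrite -(oppr_eq0 (sin _)) -sinN -mulNr opprB; apply: Gxy; by rewrite eq_sym.
  - exact: Gx.
have H m : (m <= n)%N -> charE (z m) * (sinc_prod x)%:C = charE x * (sinc_prod (z m))%:C.
  elim: m => [_|m IH mn]; first by congr (charE _ * (sinc_prod _)%:C); apply/funext.
  have Ez : z m.+1 = upd (Ordinal mn) (z m) (y (Ordinal mn)).
    apply/funext => j; rewrite /z /upd ltnS leq_eqVlt -val_eqE /=.
    by case: eqVneq => //= jm; congr y; apply: val_inj.
  have G0 : (sinc_prod (z m))%:C != 0 :> C.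
    rewrite eq_complex /= eqxx andbT; apply: sinc_prod_neq0; exact: Gz.
  apply: (mulIf G0); have := charE_upd (Gz m); rewrite -mulrA [_ * (sinc_prod (z m))%:C]mulrC mulrA.
  move=> /(_ (Ordinal mn) (y (Ordinal mn))); rewrite -Ez => -> //.
  by rewrite mulrAC IH ?(ltnW mn) // mulrAC.
have := H n (leqnn n); rewrite (_ : z n = y) //.
by apply/funext => j; rewrite /z ltn_ord.
Qed.

Let line u a e j : R := u j + a j * e.

(** Moving along the line multiplies the weight by a phase that is uniformly small, [phase a] being
    bounded on the orbit. *)
Lemma charE_line_cvg u a :
  (fun e => complex.Re (charE (line u a e))) @ 0^'+ --> complex.Re (charE u).
Proof.
have Ns := nice_subring rho.
have nw v : nice rho (weight v) := nice_weight rho v.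
have np : nice rho (phase a).
  apply: (subring_sum Ns) => j _; apply: (subring_scale Ns); exact: nice_entry.
have [_ [K HK]] := np.
have bound e : normc (charE (line u a e) - charE u) <= 2 * (2 * (`|K| * `|e|)).
  rewrite /charE -(mean_sub n0 Hmu (nw _) (nw _)); apply: (mean_norm n0 Hmu).
    exact: (subring_sub Ns (nw _) (nw _)).
  move=> b Ob; have -> : weight (line u a e) b = weight u b * expi (complex.Re (phase a b) * e).
    rewrite /weight -expiD; congr expi.
    have -> : phase (line u a e) b = phase u b + phase a b * e%:C.
      rewrite /phase mulr_suml -big_split; apply: eq_bigr => j _ /=.
      by rewrite -real_complexD -real_complexM; ring.
    by rewrite Re_add Re_mul /= mulr0 subr0.
  rewrite -[X in _ - X]mulr1 -mulrBr normcM normc_expi mul1r.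
  apply: (le_trans (normc_le _)); rewrite /= oppr0 addr0.
  have := norm_cosB1_le1 (complex.Re (phase a b) * e).
  have := norm_sin_le (complex.Re (phase a b) * e).
  have : `|complex.Re (phase a b) * e| <= `|K| * `|e|.
    rewrite normrM ler_wpM2r // (le_trans (norm_Re_le _)) // (le_trans (HK _ Ob)) //.
    exact: ler_norm.
  lra.
apply/cvgrPdist_le => d d0; near=> e.
have e0 : 0 < e by near: e; exact: nbhs_right_gt.
rewrite distrC -Re_opp -Re_add (le_trans (norm_Re_le _)) // (le_trans (bound e)) //.
have -> : 2 * (2 * (`|K| * `|e|)) = 2 * 2 * `|K| * e by rewrite (gtr0_norm e0); ring.
have K0 : 0 < 2 * 2 * (`|K| + 1) by rewrite mulr_gt0 // ltr_wpDl.
apply: (@le_trans _ _ (2 * 2 * (`|K| + 1) * e)).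
  by rewrite ler_pM2r // ler_pM2l // lerDl.
rewrite -ler_pdivlMl //; near: e; apply: nbhs_right_le.
by rewrite mulr_gt0 // invr_gt0.
Unshelve. all: by end_near. Qed.

Lemma cvg_prod_seq (T I : Type) (F : set_system T) (FF : Filter F) (s : seq I) (P : pred I)
    (f : I -> T -> R) (c : I -> R) :
  (forall i, f i @ F --> c i) ->
  (fun t => \prod_(i <- s | P i) f i t) @ F --> \prod_(i <- s | P i) c i.
Proof.
move=> H; elim: s => [|i s IH].
  by under eq_fun do rewrite big_nil; rewrite big_nil; exact: cvg_cst.
under eq_fun do rewrite big_cons; rewrite big_cons; case: (P i) => //.
by apply: cvgM.
Qed.

Lemma sinc_prod_line_cvg u a : (fun e => sinc_prod (line u a e)) @ 0^'+ --> sinc_prod u.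
Proof.
apply: cvg_prod_seq => j; apply: cvg_prod_seq => k.
have := @cvg_sinc R ((u j - u k) / 2) ((a j - a k) / 2).
rewrite (_ : (fun e => _) = (fun e => sinc ((line u a e j - line u a e k) / 2))) //.
by apply/funext => e; congr sinc; rewrite /line; field.
Qed.

Lemma charE0 : charE (fun=> 0) = 1.
Proof.
rewrite /charE; have -> : weight (fun=> 0 : R) = (fun=> 1 : C) :> ('M[C]_n -> C).
  apply/funext => b; rewrite /weight /phase big1 ?expi0 // => j _; by rewrite mul0r.
have mO : measurable (orbit_SU rho : set (borelMxC R n)) := measurable_orbit rho n0.
rewrite /orbit_mean /Cintegral /= !Rintegral_cst //; apply: complex_ext => /=.
  by rewrite mul1r (congr1 fine Hmu.1).
by rewrite mul0r.
Qed.

Lemma sinc_prod0 : sinc_prod (fun _ : 'I_n => 0 : R) = 1.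
Proof.
by rewrite /sinc_prod big1 // => j _; rewrite big1 // => k _; rewrite subrr mul0r /sinc eqxx.
Qed.

Lemma near_generic u a : (forall j k : 'I_n, j != k -> a j != a k) ->
  \forall e \near 0^'+, generic (line u a e).
Proof.
move=> Ha.
have H (j k : 'I_n) : \forall e \near (0 : R)^'+, j != k -> sin ((line u a e j - line u a e k) / 2) != 0.
  have [->|jk] := eqVneq j k; first by near=> e.
  have c0 : (a j - a k) / 2 != 0 by rewrite mulf_neq0 ?invr_eq0 ?subr_eq0 ?Ha.
  have := near_sin_neq0 ((u j - u k) / 2) c0; apply: filterS => e He _.
  by move: He; congr (sin _ != 0); rewrite /line; field.
by apply: filter_forall => j; apply: filter_forall => k; exact: H.
Unshelve. all: by end_near. Qed.

(* Both sides agree up to a constant factor at points where all the sines are nonzero;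
   such points approach [u] along [line u a] and the origin, where both sides are [1],
   along [line o a']. *)
Lemma charE_sinc u : complex.Re (charE u) = sinc_prod u.
Proof.
(* The shift by [n] makes the values of [a'] differ from all those of [a], so that mixed differences
   are not constant along the two lines either. *)
pose a (j : 'I_n) : R := j%:R; pose a' (j : 'I_n) : R := (j + n)%:R.
have Ha j k : j != k -> a j != a k by rewrite /a eqr_nat.
have Ha' j k : j != k -> a' j != a' k by rewrite /a' eqr_nat eqn_add2r.
pose o (j : 'I_n) : R := 0.
have cvgM0 (f g : R -> R) (b c : R) : f @ 0^'+ --> b -> g @ 0^'+ --> c ->
    (fun e => f e * g e) @ 0^'+ --> b * c by move=> Hf Hg; exact: cvgM.
have C1 := cvgM0 _ _ _ _ (@charE_line_cvg o a') (@sinc_prod_line_cvg u a).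
have C2 := cvgM0 _ _ _ _ (@charE_line_cvg u a) (@sinc_prod_line_cvg o a').
have cross : \forall e \near (0 : R)^'+, forall j k, sin ((line o a' e j - line u a e k) / 2) != 0.
  apply: filter_forall => j; apply: filter_forall => k.
  have c0 : (a' j - a k) / 2 != 0.
    by rewrite mulf_neq0 ?invr_eq0 // subr_eq0 eqr_nat gtn_eqF // ltn_addl.
  have := near_sin_neq0 ((o j - u k) / 2) c0; apply: filterS => e He.
  by move: He; congr (sin _ != 0); rewrite /line; field.
have CC : (fun e => complex.Re (charE (line o a' e)) * sinc_prod (line u a e)) @ 0^'+ -->
    complex.Re (charE u) * sinc_prod o.
  apply: cvg_trans C2; apply: near_eq_cvg; near=> e.
  have G1 : generic (line u a e) by near: e; exact: near_generic.
  have G2 : generic (line o a' e) by near: e; exact: near_generic.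
  have /(congr1 (@complex.Re R)) : charE (line o a' e) * (sinc_prod (line u a e))%:C =
      charE (line u a e) * (sinc_prod (line o a' e))%:C.
    have cr : forall j k, sin ((line o a' e j - line u a e k) / 2) != 0 by near: e.
    exact: charE_cross.
  by rewrite !Re_mul /= !mulr0 !subr0 => ->.
have := cvg_unique _ CC C1; rewrite /o sinc_prod0 charE0 mulr1 mul1r; apply.
exact: norm_hausdorff.
Unshelve. all: by end_near. Qed.

End ProductFormula.

(** * The bound at [rho] *)

Lemma rho_cartan (R : realType) n : (0 < n)%N -> cartanR R n (rho R n).
Proof.
move=> n0; rewrite /cartanR /=; set S := \sum_(i < n) _.
(* Reversing the indices negates [rho]. *)
have S2 : S = - S.
  rewrite {1}/S (reindex_inj rev_ord_inj) /= -sumrN; apply: eq_bigr => j _.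
  rewrite !mxE /= natrB ?ltn_ord // -[in n%:R](prednK n0) -[j.+1]addn1 -[n.-1.+1]addn1 !natrD.
  by field.
by lra.
Qed.

Lemma rho_neq0 (R : realType) n : (2 <= n)%N -> rho R n != 0.
Proof.
case: n => // n n1; apply/eqP => /matrixP/(_ 0 ord0); rewrite !mxE /= subr0 => /eqP.
by rewrite mulf_eq0 invr_eq0 !pnatr_eq0 orbF => /eqP E; move: n1; rewrite E.
Qed.

Lemma orbit_neq0 (R : realType) n (l : 'rV[R]_n) : l != 0 -> ~ orbit_SU l 0.
Proof.
move=> /eqP l0 [U [uU _]] H; apply: l0; apply/rowP => j.
have uu := unitarymx_unit uU.
have : cartan_mx l = 0.
  have := congr1 (fun X => invmx U *m X *m U) H.
  by rewrite /coadjoint !mulmxA mulVmx // mul1mx mulmxKV // mulmx0 mul0mx.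
move=> /matrixP/(_ j j); rewrite !mxE eqxx mulr1n => /(congr1 (@complex.Re R)) /= ->.
by [].
Qed.

Lemma Cintegral_dirac_eq0 (d : measure_display) (T : measurableType d) (R : realType)
  (a : T) (D : set T) (f : T -> R[i]) : ~ D a -> Cintegral (\d_a) D f = 0.
Proof.
move=> Da; have H (g : T -> R) : \int[\d_a]_(t in D) g t = 0.
  rewrite /Rintegral (eq_measure_integral mzero) ?integral_measure_zero // => S mS SD.
  by rewrite /= /dirac indicE memNset // => /SD.
by rewrite /Cintegral !H.
Qed.

(** The diagonal entries are real on the orbit, so the exponent is purely imaginary and the real
    part in [weight] changes nothing. *)
Lemma cexp_pairing (R : realType) n (l x : 'rV[R]_n) b : (0 < n)%N -> orbit_SU l b ->
  cexp ('i * pairing b (cartan_mx x)) = weight (fun j => x 0 j) b.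
Proof.
move=> n0 Ob.
have -> : pairing b (cartan_mx x) = (complex.Re (phase (fun j => x 0 j) b))%:C.
  have -> : pairing b (cartan_mx x) = phase (fun j => x 0 j) b.
    rewrite /pairing /mxtrace /phase; apply: eq_bigr => j _.
    by rewrite mul_mx_diag !mxE mulrC.
  rewrite /phase (big_morph (@complex.Re R) (@Re_add R) erefl) rmorph_sum /=.
  apply: eq_bigr => j _; rewrite [in LHS](orbit_diag_real j n0 Ob) Re_mul /= mul0r subr0.
  by rewrite real_complexM.
rewrite /cexp /weight; set r := complex.Re (phase _ b).
have -> : 'i * r%:C = 0 +i* r by apply: complex_ext => /=; ring.
by rewrite /= expR0 !mul1r.
Qed.

Lemma asymp_char_rho (R : realType) n (x : 'rV[R]_n) : (2 <= n)%N ->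
  - (4 / pi ^+ 2) ^+ (n - 2) <= complex.Re (asymp_char (rho R n) x).
Proof.
move=> n2; have n0 : (0 < n)%N by exact: leq_trans n2.
rewrite /asymp_char /orbit_measure.
have [ex|nex] := pselect (exists mu, is_orbit_measure (rho R n) mu).
  have Hmu := xgetPex (\d_(0 : borelMxC R n) : {classic probability (borelMxC R n) R}) ex.
  set mu := xget _ _ in Hmu *.
  have := charE_sinc n0 Hmu (fun j => x 0 j).
  have <- : orbit_mean (rho R n) mu (fun b => cexp ('i * pairing b (cartan_mx x))) =
      charE mu (fun j => x 0 j).
    by apply: mean_ext => b Ob; exact: (cexp_pairing x n0 Ob).
  by rewrite /orbit_mean => ->; exact: sinc_prod_ge.
(* The default value of [xget] is the Dirac mass at [0], which is off the orbit. *)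
rewrite xgetPN => [|mu Hmu]; last by apply: nex; exists mu.
rewrite Cintegral_dirac_eq0; last exact/orbit_neq0/rho_neq0.
by rewrite oppr_le0 exprn_ge0 // divr_ge0 // exprn_ge0 // pi_ge0.
Qed.

Theorem proposition6p1 (R : realType) (n : nat) (hn : (2 <= n)%N) :
  (c_SL R n <= ((4 / pi ^+ 2) ^+ (n - 2))%:E)%E.
Proof.
apply: (@le_trans _ _ (c_SL_at (rho R n))).
  apply: ereal_inf_lbound; exists (rho R n) => //; split; last exact: rho_neq0.
  by apply: rho_cartan; exact: leq_trans hn.
rewrite /c_SL_at leeNl -EFinN; apply: le_ereal_inf_tmp => _ [x _ <-].
by rewrite lee_fin; exact: asymp_char_rho.
Qed.
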